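(* Let $\phi : \mathbb{D}\to\mathbb{D}$ be a real and $\omega$-radial symbol, where $\omega : [0,1]\to[0,2]$ is a (concave) modulus of continuity. Then there is a constant $c > 0$, depending only on $\phi$, such that, with $a = 1 - \phi(0) > 0$, the approximation numbers of the composition operator $C_\phi : H^2 \to H^2$ satisfy, for every $n \geq 1$: $$a_n(C_\phi) \geq c\, \sup_{0<\sigma<1} \sqrt{\frac{\omega^{-1}(a\,\sigma^n)}{a\,\sigma^n}}\ \exp\bigg[-\frac{20}{1-\sigma}\bigg].$$
   Context: $\mathbb{D}$ is the open unit disk. For an analytic $\phi : \mathbb{D} \to \mathbb{D}$, $C_\phi(f) = f\circ\phi$ is the composition operator on the Hardy space $H^2$ of the disk (always bounded). The approximation numbers of a bounded operator $T$ are $a_n(T) = \inf\{\|T - R\| : \mathrm{rank}\,(R) < n\}$, $n = 1,2,\ldots$ A modulus of continuity is a continuous function $\omega : [0,A]\to\mathbb{R}^+$ which is increasing, sub-additive and vanishes at $0$; throughout, moduli of continuity are assumed concave, so that $x\mapsto\omega^{-1}(x)/x$ is non-decreasing, where $\omega^{-1}$ is the inverse function of $\omega$. An analytic map $\phi:\mathbb{D}\to\mathbb{D}$ is real if it takes real values on $]-1,1[$. It is an $\omega$-radial symbol if it is real and $\omega:[0,1]\to[0,2]$ is a modulus of continuity such that $1 - \phi(r) \leq \omega(1-r)$ for all $0 \leq r < 1$. *)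

(* Defs.v *)
From HB Require Import structures.
From mathcomp Require Import all_boot all_order all_algebra.
From mathcomp Require Import all_classical all_reals all_analysis.
From mathcomp Require Import complex ring.
Set Implicit Arguments.
Unset Strict Implicit.
Unset Printing Implicit Defensive.
Import Order.TTheory GRing.Theory Num.Theory numFieldNormedType.Exports.
Local Open Scope classical_set_scope.
Local Open Scope ring_scope.

(* [R[i]^o] is [R[i]] seen as a normed module over itself, so that limits and
   [derivable] below are the complex ones; the norm [`|z|] of a complex number
   is itself a complex number, and [Normc.normc z : R] is the same modulus as a
   real number. *)
Definition disk (R : realType) : set R[i]^o := [set z | `|z| < 1].
Arguments disk R : clear implicits.

Lemma disk0_subproof (R : realType) : (0 : R[i]^o) \in disk R.
Proof. by rewrite inE /disk /= normr0 ltr01. Qed.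

Definition disk0 (R : realType) : disk R := exist _ 0 (disk0_subproof R).

(* The disk being open, the extension of [f] by zero is only a device to apply
   [derivable], which wants a function on the whole plane. *)
Definition analytic (R : realType) (f : disk R -> R[i]^o) : Prop :=
  forall z : disk R, derivable ('valL_0 f) (\val z) 1.

Section HardySpace.
Variable R : realType.

Definition taylor (f : disk R -> R[i]^o) (a : nat -> R[i]^o) : Prop :=
  forall z : disk R,
    series (fun k => a k * (\val z : R[i]^o) ^+ k) @ \oo --> f z.

(* The Taylor coefficients of [f] at 0 are unique, so the infimum ranges over
   at most one element: it is (sum |a_k|^2)^(1/2) if [f] is the sum of a power
   series on the disk, and +oo otherwise. *)
Definition hardy_norm (f : disk R -> R[i]^o) : \bar R :=
  ereal_inf [set sqrte (\sum_(0 <= k <oo) (Normc.normc (a k) ^+ 2)%:E)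
            | a in taylor f].

Definition hardy : {pred (disk R -> R[i]^o)} :=
  fun f => (hardy_norm f < +oo)%E.

Lemma sqrte_ltoo (x : \bar R) : (sqrte x < +oo)%E = (x < +oo)%E.
Proof. by case: x => [r| |] //=; rewrite !ltry. Qed.

Lemma hardyP (f : disk R -> R[i]^o) :
  f \in hardy <-> exists2 a, taylor f a &
    (\sum_(0 <= k <oo) (Normc.normc (a k) ^+ 2)%:E < +oo)%E.
Proof.
rewrite unfold_in /hardy_norm; split.
  by move/ereal_inf_lt => [_ [a fa <-]]; rewrite sqrte_ltoo => ?; exists a.
move=> [a fa afin]; apply: (@le_lt_trans _ _
  (sqrte (\sum_(0 <= k <oo) (Normc.normc (a k) ^+ 2)%:E)%E)).
  by apply: ereal_inf_lbound; exists a.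
by rewrite sqrte_ltoo.
Qed.

Lemma hardy_submod_closed : submod_closed hardy.
Proof.
split.
  apply/hardyP; exists (fun=> 0).
    move=> z; rewrite (_ : series _ = cst 0); first exact: cvg_cst.
    by apply/funext => n; rewrite /series /= big1 // => k _; rewrite mul0r.
  by rewrite eseries0 // => k _ _; rewrite Normc.normc0 expr0n.
move=> c f g /hardyP[a fa afin] /hardyP[b gb bfin]; apply/hardyP.
exists (fun k => c * a k + b k).
  move=> z; rewrite (_ : series _ =
    (fun n => c *: series (fun k => a k * (\val z : R[i]^o) ^+ k) n
              + series (fun k => b k * (\val z : R[i]^o) ^+ k) n)); last first.
    apply/funext => n; rewrite /series /= scaler_sumr -big_split /=.
    by apply: eq_bigr => k _; rewrite mulrDl -mulrA.
  by apply: cvgD; [apply: cvgZr; exact: fa|exact: gb].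
pose A k := (Normc.normc (a k) ^+ 2)%:E.
pose B k := (Normc.normc (b k) ^+ 2)%:E.
pose M := 2 * Normc.normc c ^+ 2.
have M0 : 0 <= M by rewrite mulr_ge0 // sqr_ge0.
apply: (@le_lt_trans _ _ (\sum_(0 <= k <oo) (M%:E * A k + 2%:E * B k))%E).
  apply: lee_nneseries => [k _ _|k _]; first by rewrite lee_fin sqr_ge0.
  rewrite /A /B /M -!EFinM -EFinD lee_fin.
  have h := le_normcD (c * a k) (b k).
  have n0 x : 0 <= Normc.normc x :> R by case: x => x y; exact: sqrtr_ge0.
  rewrite Normc.normcM in h.
  move: h (n0 (c * a k + b k)) (n0 c) (n0 (a k)) (n0 (b k)).
  move: (Normc.normc _) (Normc.normc c) (Normc.normc (a k)) (Normc.normc (b k)).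
  move=> s u v w suvw s0 u0 v0 w0.
  apply: (@le_trans _ _ ((u * v + w) ^+ 2)).
    by rewrite lerXn2r ?nnegrE // addr_ge0 // mulr_ge0.
  rewrite -subr_ge0 (_ : _ - _ = (u * v - w) ^+ 2) ?sqr_ge0 //.
  by rewrite sqrrD sqrrB exprMn -mulrA !mulr_natl !mulr2n; ring.
have A0 k : (0 <= A k)%E by rewrite lee_fin sqr_ge0.
have B0 k : (0 <= B k)%E by rewrite lee_fin sqr_ge0.
rewrite nneseriesD; last 2 first.
- by move=> k _ _; rewrite mule_ge0.
- by move=> k _ _; rewrite mule_ge0.
rewrite !nneseriesZl //.
by rewrite lte_add_pinfty // lte_mul_pinfty.
Qed.

HB.instance Definition _ :=
  GRing.isSubmodClosed.Build _ _ hardy hardy_submod_closed.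

Record H2 : Type := MkH2 { H2val :> disk R -> R[i]^o; _ : H2val \in hardy }.

HB.instance Definition _ := [isSub for H2val].
HB.instance Definition _ := [Choice of H2 by <:].
HB.instance Definition _ := [SubChoice_isSubLmodule of H2 by <:].

(* Operators on H^2 are allowed to take values in arbitrary functions on the
   disk, whose norm is then +oo if they are not in H^2. *)
Definition opnorm (T : H2 -> disk R -> R[i]^o) : \bar R :=
  ereal_sup [set hardy_norm (T f) | f in [set f : H2 | hardy_norm f <= 1]%E].

Definition rank_lt (n : nat) (S : H2 -> H2) : Prop :=
  exists (m : nat) (g : 'I_m -> H2), (m < n)%N /\
    forall f : H2, exists x : 'I_m -> R[i], S f = \sum_(i < m) x i *: g i.

Definition bounded_op (S : H2 -> H2) : Prop := (opnorm S < +oo)%E.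

Definition approx_number (n : nat) (T : H2 -> disk R -> R[i]^o) : \bar R :=
  ereal_inf [set opnorm (fun f => T f - H2val (S f))
            | S in [set S : {linear H2 -> H2} | bounded_op S /\ rank_lt n S]].

Definition composition_op (phi : disk R -> disk R) (f : H2) :
  disk R -> R[i]^o := f \o phi.

End HardySpace.

Record modulus_of_continuity (R : realType) (A : R) (omega : R -> R) : Prop := {
  modulus_ge0 : forall x, 0 <= x <= A -> 0 <= omega x;
  modulus_continuous : {within `[0, A], continuous omega};
  modulus_increasing : {in `[0, A] &, {homo omega : x y / x < y}};
  modulus_subadditive : forall x y, 0 <= x -> 0 <= y -> x + y <= A ->
    omega (x + y) <= omega x + omega y;
  modulus0 : omega 0 = 0;
  modulus_concave : convex_function (`[0, A]%classic : set R^o) (\- omega) }.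

Definition modulus_inv (R : realType) (A : R) (omega : R -> R) : R -> R :=
  'pinv_(fun=> 0) `[0, A] omega.

Lemma modulus_invK (R : realType) (A : R) (omega : R -> R) :
  modulus_of_continuity A omega ->
  forall x, 0 <= x <= A -> modulus_inv A omega (omega x) = x.
Proof.
move=> m x xA; apply: pinvKV; last by rewrite inE /= in_itv.
move=> y z; rewrite !inE /= => yA zA yz; apply/eqP; rewrite eq_le !leNgt.
by apply/andP; split; apply/negP => /(modulus_increasing m);
  rewrite yz ltxx => /(_ _ _) h; have := h ltac:(by []) ltac:(by []).
Qed.

Definition real_symbol (R : realType) (phi : disk R -> disk R) : Prop :=
  forall z : disk R, complex.Im (\val z) = 0 -> complex.Im (\val (phi z)) = 0.

(* Since [phi] is real, [complex.Re] only converts from R[i] to R. *)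
Definition radial_symbol (R : realType) (omega : R -> R)
    (phi : disk R -> disk R) : Prop :=
  [/\ real_symbol phi,
      modulus_of_continuity 1 omega,
      forall x, 0 <= x <= 1 -> 0 <= omega x <= 2 &
      forall z : disk R, complex.Im (\val z) = 0 -> 0 <= complex.Re (\val z) ->
        1 - complex.Re (\val (phi z)) <= omega (1 - complex.Re (\val z))].

(* Main.v *)
Require Import Defs.
From mathcomp Require Import all_boot all_order all_algebra.
From mathcomp Require Import all_classical all_reals all_analysis.
From mathcomp Require Import complex separable cyclic cyclotomic ring lra.
Import Order.TTheory GRing.Theory Num.Theory numFieldNormedType.Exports.
Local Open Scope classical_set_scope.
Local Open Scope ring_scope.

Set Implicit Arguments.
Unset Strict Implicit.
Unset Printing Implicit Defensive.

(** Let [S] be an operator of rank less than [n] and let [v_1, ..., v_n] be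
    distinct points of the disk. Some nonzero combination [h] of the reproducing
    kernels at the [v_j] is killed by [S], so the norm of [C_phi - S] is at least
    [|h o phi| / |h|]. Fix [sigma]; as [1 - phi] tends to 0 along the radius,
    there are points [0 < u_1 < u_2 < ... < 1] with [1 - phi u_j = a * sigma ^ j],
    and the kernels are taken at [v_j = phi u_j]. Two estimates bound the ratio
    from below.

    - Interpolation at the [v_j] ([kernel_form_le]): with [C = 8 / (1 - sigma)],
      [|h|^2 <= exp (24 / (1 - sigma)) * C * sum (1 - v_j^2) |h v_j|^2].
    - A Carleson embedding at the [u_j] ([carleson_embedding]), applied to
      [g = h o phi], which takes the values [h v_j] at the [u_j]:
      [sum (1 - u_j^2) |g u_j|^2 <= C * |g|^2].

    Both rest on one fact, that the images of the points under
    [t x = (1 - x) / (1 + x)] decrease at least as fast as the powers of [sigma].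
    In the coordinate [t] the Gram matrix of normalised kernels has entries
    [2 sqrt (t_i t_j) / (t_i + t_j)], at most [2 sigma ^ (|i - j| / 2)], and
    Schur's test applies: this gives the second estimate by duality. For the
    first one, that matrix is a Cauchy matrix, whose inverse is the same matrix
    with rows and columns multiplied by reciprocals of the Blaschke products
    [prod_(l != j) (t_j - t_l) / (t_j + t_l)]; these products are at least
    [exp (- 12 / (1 - sigma))] in modulus ([separation_product_ge]).

    The decay of [t v_j] is a computation. That of [t u_j] is Harnack's inequality
    for the positive harmonic function [1 - Re phi] ([harnack]). It is derived
    from the Taylor series of [phi], the Poisson integral being replaced by
    averages over roots of unity; this series is at hand because [phi] is the
    image of the identity function under [C_phi], hence lies in [H^2] as soon as
    the norm of [C_phi - S] is finite.

    Finally [(1 - u_j^2) / (1 - v_j^2)] is at least half of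
    [(1 - u_j) / (a * sigma ^ j)], which by concavity of [omega] is at least
    [omega^-1 (a * sigma ^ n) / (a * sigma ^ n)] ([modulus_inv_ratio_le]). The
    remaining factor [1 - sigma] exceeds [exp (- 8 / (1 - sigma))], whence the
    constant 20 in the exponent, and [c = 1 / 16]. *)

(** * Schur's test *)

Definition idist (i j : nat) : nat := ((i - j) + (j - i))%N.

Lemma idistC (i j : nat) : idist i j = idist j i.
Proof. by rewrite /idist addnC. Qed.

Lemma sum_idist_le (R : realType) (f : nat -> R) (n : nat) (i : 'I_n) :
  (forall k, 0 <= f k) ->
  \sum_(j < n) f (idist i j) <= 2 * \sum_(k < n) f k.
Proof.
move=> f0.
have sub (m p : nat) : (m <= p)%N ->
    \sum_(0 <= k < m) f k <= \sum_(0 <= k < p) f k.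
  by move=> mp; rewrite [leRHS](@big_cat_nat _ _ _ m) //= lerDl sumr_ge0.
rewrite -!(big_mkord xpredT) -(big_mkord xpredT (fun j => f (idist i j))).
rewrite (@big_cat_nat _ _ _ i) //=; last exact: ltnW.
rewrite mulr_natl mulr2n lerD //.
  rewrite big_nat_rev /= add0n (eq_big_nat _ _ (F2 := fun k => f k.+1)).
    apply: (le_trans _ (sub i.+1 n _)) => //.
    by rewrite big_nat_recl // lerDr.
  move=> k /andP[_ ki]; congr f; rewrite /idist.
  by rewrite subKn // (eqP (_ : _ - _ == 0)%N) ?addn0 // subn_eq0 leq_subr.
rewrite -{1}[i : nat]add0n big_addn.
rewrite (eq_big_nat _ _ (F2 := f)); first by apply: sub; exact: leq_subr.
move=> k _; congr f; rewrite /idist addnK.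
by rewrite (eqP (_ : _ - _ == 0)%N) // subn_eq0 leq_addl.
Qed.

Lemma sum_geometric_le (R : realType) (q : R) (n : nat) :
  0 <= q -> q < 1 -> \sum_(k < n) q ^+ k <= (1 - q)^-1.
Proof.
move=> q0 q1; have q1' : 0 < 1 - q by rewrite subr_gt0.
rewrite -(ler_pM2l q1') divff ?gt_eqF //.
by rewrite -opprB mulNr -subrX1 opprB gerBl exprn_ge0.
Qed.

(** The inequality [2 y_i y_j <= y_i^2 + y_j^2] reduces the form to its row sums. *)
Lemma schur_test (R : realType) (n : nat) (A : 'I_n -> 'I_n -> R) (C : R)
    (y : 'I_n -> R) :
  (forall i j, A i j = A j i) -> (forall i j, 0 <= A i j) ->
  (forall i, \sum_(j < n) A i j <= C) ->
  \sum_(i < n) \sum_(j < n) A i j * (y i * y j) <= C * \sum_(i < n) y i ^+ 2.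
Proof.
move=> symA A0 rowA.
have row : \sum_(i < n) \sum_(j < n) A i j * y i ^+ 2
    <= C * \sum_(i < n) y i ^+ 2.
  rewrite mulr_sumr; apply: ler_sum => i _.
  by rewrite -mulr_suml ler_wpM2r ?sqr_ge0.
have col : \sum_(i < n) \sum_(j < n) A i j * y j ^+ 2
    = \sum_(i < n) \sum_(j < n) A i j * y i ^+ 2.
  by rewrite exchange_big; do 2![apply: eq_bigr => ? _]; rewrite symA.
rewrite -(ler_pM2l (_ : 0 < 2 :> R)) //.
apply: (@le_trans _ _ (\sum_(i < n) \sum_(j < n) A i j * y i ^+ 2
    + \sum_(i < n) \sum_(j < n) A i j * y j ^+ 2)); last first.
  by rewrite col; lra.
rewrite -big_split mulr_sumr; apply: ler_sum => i _ /=.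
rewrite -big_split mulr_sumr; apply: ler_sum => j _ /=.
rewrite -mulrDr mulrCA ler_wpM2l //.
rewrite -subr_ge0 (_ : _ - _ = (y i - y j) ^+ 2) ?sqr_ge0 //; ring.
Qed.

(** When the [t i] are the Cayley images of real points of the disk, this geometric
    decay separates the points in the hyperbolic metric. *)
Definition decays (R : realType) (sigma : R) (n : nat) (t : 'I_n -> R) : Prop :=
  forall i j : 'I_n, (i <= j)%N -> t j <= sigma ^+ (j - i) * t i.

(** The entries are at most [2 q ^ |i - j|] with [q = sqrt sigma], so that the row
    sums are at most [4 / (1 - q)], which is at most [8 / (1 - q ^ 2)]. *)
Lemma schur_test_decays (R : realType) (sigma : R) (n : nat) (t y : 'I_n -> R) :
  0 < sigma < 1 -> (forall i, 0 < t i) -> decays sigma t ->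
  \sum_(i < n) \sum_(j < n)
     2 * (Num.sqrt (t i) * Num.sqrt (t j)) / (t i + t j) * (y i * y j)
  <= 8 / (1 - sigma) * \sum_(i < n) y i ^+ 2.
Proof.
move=> /andP[s0 s1] t0 dec.
have sq i : t i = Num.sqrt (t i) ^+ 2 by rewrite sqr_sqrtr ?ltW.
have sq0 i : 0 < Num.sqrt (t i) by rewrite sqrtr_gt0.
set q := Num.sqrt sigma.
have q0 : 0 < q by rewrite sqrtr_gt0.
have qE : sigma = q ^+ 2 by rewrite sqr_sqrtr ?ltW.
have q1 : q < 1 by rewrite -sqrtr1 ltr_sqrt.
pose A i j := 2 * (Num.sqrt (t i) * Num.sqrt (t j)) / (t i + t j).
have symA i j : A i j = A j i by rewrite /A [_ * Num.sqrt _]mulrC [t i + _]addrC.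
have A0 i j : 0 <= A i j.
  by rewrite /A divr_ge0 ?mulr_ge0 ?ltW ?addr_gt0.
have Ale i j : A i j <= 2 * q ^+ idist i j.
  wlog ij : i j / (i <= j)%N => [wl|].
    case/orP: (leq_total i j) => ?; first exact: wl.
    by rewrite symA idistC; exact: wl.
  rewrite /idist (eqP (_ : i - j == 0)%N) ?subn_eq0 // add0n.
  have h : Num.sqrt (t j) <= q ^+ (j - i) * Num.sqrt (t i).
    rewrite -(@ler_pXn2r _ 2) ?nnegrE ?mulr_ge0 ?exprn_ge0 //;
      rewrite ?(ltW (sq0 _)) ?(ltW q0) //.
    rewrite exprMn -exprM mulnC exprM -qE -!sq. exact: dec.
  rewrite /A ler_pdivrMr ?addr_gt0 // -mulrA ler_pM2l //.
  apply: (@le_trans _ _ (q ^+ (j - i) * t i)).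
    have := ler_wpM2l (ltW (sq0 i)) h.
    by rewrite mulrCA -expr2 -sq.
  by rewrite ler_pM2l ?exprn_gt0 // lerDl ltW.
have rowA i : \sum_(j < n) A i j <= 8 / (1 - sigma).
  apply: (@le_trans _ _ (\sum_(j < n) 2 * q ^+ idist i j)); first exact: ler_sum.
  rewrite -mulr_sumr.
  apply: (@le_trans _ _ (2 * (2 * \sum_(k < n) q ^+ k))).
    rewrite ler_pM2l //; apply: (@sum_idist_le _ (fun k => q ^+ k)) => k.
    by rewrite exprn_ge0 ?ltW.
  apply: (@le_trans _ _ (2 * (2 * (1 - q)^-1))).
    by rewrite !ler_pM2l // sum_geometric_le ?ltW.
  rewrite qE; have -> : 1 - q ^+ 2 = (1 - q) * (1 + q) by ring.
  have d1 : 0 < 1 - q by rewrite subr_gt0.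
  have d2 : 0 < 1 + q by rewrite addr_gt0.
  have X0 : 0 < (1 - q)^-1 by rewrite invr_gt0.
  have Y2 : 1 <= 2 * (1 + q)^-1 by rewrite ler_pdivlMr //; lra.
  by rewrite invfM; nra.
exact: (@schur_test _ _ A).
Qed.

(** * Separation of geometric sequences *)

(** With [s = sqrt (1 - x)] the claim becomes a polynomial inequality in [s] once
    the exponential is bounded below by [(1 + 3 x / (2 s)) ^ 2]. The point of the
    bound is that [1 / sqrt (1 - x)] is integrable up to 1, so that the exponents
    of [x = sigma ^ k] have a sum of order [1 / (1 - sigma)]. *)
Lemma ratio_ge_expR (R : realType) (x : R) : 0 <= x < 1 ->
  expR (- (3 * x / Num.sqrt (1 - x))) <= (1 - x) / (1 + x).
Proof.
move=> /andP[x0 x1]; set s := Num.sqrt (1 - x).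
have s0 : 0 < s by rewrite sqrtr_gt0 subr_gt0.
have xE : x = 1 - s ^+ 2 by rewrite sqr_sqrtr ?subr_ge0 ?ltW //; ring.
have s1 : s <= 1 by rewrite -sqrtr1 ler_sqrt; lra.
rewrite expRN -[leRHS]invrK lef_pV2 ?posrE ?expR_gt0 ?invr_gt0 ?divr_gt0; try lra.
rewrite invf_div.
have -> : 3 * x / s = 3 / 2 * x / s + 3 / 2 * x / s by field; rewrite gt_eqF.
rewrite expRD.
have h0 : 0 <= 3 / 2 * x / s by rewrite divr_ge0 ?mulr_ge0 // ltW.
have h : 1 + 3 / 2 * x / s <= expR (3 / 2 * x / s) by exact: expR_ge1Dx.
have h1 : 0 <= 1 + 3 / 2 * x / s by lra.
apply: le_trans (ler_pM h1 h1 h h).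
have -> : 1 - x = s ^+ 2 by rewrite xE; ring.
have -> : 1 + 3 / 2 * x / s = (s + 3 / 2 * x) / s by field; rewrite gt_eqF.
rewrite mulf_div -expr2 ler_pM2r ?invr_gt0 ?exprn_gt0 // xE -subr_ge0.
have [e sE] : exists e, s = 1 - e by exists (1 - s); ring.
rewrite (_ : _ - _ = e * ((1 - e) * (2 + 2 * e + 2 * (e * (1 - e)))
  + e ^+ 3 / 4)); last by rewrite sE; field.
have e0 : 0 <= e by lra.
have : 0 <= 1 - e by rewrite -sE ltW.
move: (1 - e) => f f0.
by do ![apply: mulr_ge0 | apply: addr_ge0 | apply: exprn_ge0 | rewrite ?invr_ge0 //].
Qed.

(** These exponents telescope: up to the factor [1 - sigma] they are the increments
    of [- 6 sqrt (1 - x)] between consecutive points [sigma ^ k], and the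
    derivative [3 / sqrt (1 - x)] of that function is the exponent of
    [ratio_ge_expR] divided by [x]. The value at [k = 0] is 0. *)
Definition separation_exponent (R : realType) (sigma : R) (k : nat) : R :=
  6 * (Num.sqrt (1 - sigma ^+ k) - Num.sqrt (1 - sigma ^+ k.-1)) / (1 - sigma).

Lemma separation_exponent_ge0 (R : realType) (sigma : R) (k : nat) : 0 < sigma < 1 ->
  0 <= separation_exponent sigma k.
Proof.
move=> /andP[s0 s1]; rewrite /separation_exponent divr_ge0 ?subr_ge0 ?(ltW s1) //.
rewrite mulr_ge0 // subr_ge0 ler_wsqrtr // lerD2l lerN2.
by rewrite ler_wiXn2l ?(ltW s0) ?(ltW s1) // leq_pred.
Qed.

Lemma sum_separation_exponent_le (R : realType) (sigma : R) (n : nat) : 0 < sigma < 1 ->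
  \sum_(k < n) separation_exponent sigma k <= 6 / (1 - sigma).
Proof.
move=> /andP[s0 s1]; have d0 : 0 < 1 - sigma by rewrite subr_gt0.
case: n => [|n]; first by rewrite big_ord0 divr_ge0 // ltW.
have -> : \sum_(k < n.+1) separation_exponent sigma k
    = 6 * Num.sqrt (1 - sigma ^+ n) / (1 - sigma).
  elim: n => [|n IH].
    by rewrite big_ord1 /separation_exponent /= !expr0 !subrr sqrtr0 !mulr0.
  by rewrite big_ord_recr /= IH /separation_exponent /=; ring.
rewrite ler_pM2r ?invr_gt0 // ler_piMr // -[leRHS]sqrtr1 ler_wsqrtr //.
by rewrite gerBl exprn_ge0 // ltW.
Qed.

Lemma expR_separation_exponent_le (R : realType) (sigma : R) (k : nat) : 0 < sigma < 1 ->
  (0 < k)%N ->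
  expR (- separation_exponent sigma k) <= (1 - sigma ^+ k) / (1 + sigma ^+ k).
Proof.
move=> /andP[s0 s1]; case: k => // k _; rewrite /separation_exponent /=.
set x := sigma ^+ k.+1; set y := sigma ^+ k.
have xy : x = sigma * y by rewrite /x exprS.
have y0 : 0 < y by rewrite exprn_gt0.
have y1 : y <= 1 by rewrite exprn_ile1 // ltW.
have x0 : 0 < x by rewrite exprn_gt0.
have x1 : x < 1 by rewrite exprn_ilt1 // ltW.
have d0 : 0 < 1 - sigma by rewrite subr_gt0.
clearbody x y.
apply: le_trans (ratio_ge_expR (_ : 0 <= x < 1)); last by rewrite (ltW x0).
rewrite ler_expR lerN2.
set s := Num.sqrt (1 - x); set r := Num.sqrt (1 - y).
have s0' : 0 < s by rewrite sqrtr_gt0 subr_gt0.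
have r0 : 0 <= r by exact: sqrtr_ge0.
have sx : s ^+ 2 = 1 - x by rewrite sqr_sqrtr // subr_ge0 ltW.
have ry : r ^+ 2 = 1 - y by rewrite sqr_sqrtr // subr_ge0.
rewrite ler_pdivlMr // mulrAC ler_pdivrMr //.
have rs : r <= s by rewrite ler_wsqrtr // lerD2l lerN2 xy ler_piMl ?ltW.
have e : y * (1 - sigma) = (s - r) * (s + r).
  have -> : (s - r) * (s + r) = s ^+ 2 - r ^+ 2 by ring.
  by rewrite sx ry xy; ring.
have : x * (1 - sigma) <= y * (1 - sigma).
  by rewrite ler_pM2r // xy ler_piMl ?ltW.
have : 0 <= (s - r) * (s - r) by rewrite mulr_ge0 // subr_ge0.
rewrite e; clearbody s r; nra.
Qed.

(** The factor of index [j] is at least [(1 - q) / (1 + q)] with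
    [q = sigma ^ |i - j|], hence at least an exponential whose exponents add up to
    at most [6 / (1 - sigma)] on each side of [i]. *)
Lemma separation_product_ge (R : realType) (sigma : R) (n : nat) (t : 'I_n -> R)
    (i : 'I_n) :
  0 < sigma < 1 -> (forall j, 0 < t j) -> decays sigma t ->
  expR (- (12 / (1 - sigma)))
  <= \prod_(j < n | j != i) (`|t i - t j| / (t i + t j)).
Proof.
move=> s01 t0 dec; have /andP[s0 s1] := s01.
apply: (@le_trans _ _ (\prod_(j < n | j != i) expR (- separation_exponent sigma (idist i j)))).
  rewrite -expR_sum ler_expR sumrN lerN2.
  apply: (@le_trans _ _ (\sum_(j < n) separation_exponent sigma (idist i j))).
    rewrite [leRHS](bigD1 i) //= lerDr; exact: separation_exponent_ge0.
  apply: le_trans (sum_idist_le _ _) _; first by move=> k; exact: separation_exponent_ge0.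
  have := sum_separation_exponent_le n s01; lra.
apply: ler_prod => j ji; rewrite expR_ge0 /=.
have key (k l : 'I_n) : (k < l)%N ->
    expR (- separation_exponent sigma (idist k l)) <= `|t k - t l| / (t k + t l).
  move=> kl; have h := dec k l (ltnW kl).
  rewrite /idist (eqP (_ : k - l == 0)%N) ?subn_eq0 1?ltnW // add0n.
  apply: le_trans (expR_separation_exponent_le s01 (_ : (0 < l - k)%N)) _;
    first by rewrite subn_gt0.
  set q := sigma ^+ (l - k) in h *.
  have q0 : 0 < q by rewrite exprn_gt0.
  have q1 : q < 1 by rewrite exprn_ilt1 ?(ltW s0) // -lt0n subn_gt0.
  have tk := t0 k; have tl := t0 l.
  rewrite ler_pdivrMr ?addr_gt0 // mulrAC ler_pdivlMr ?addr_gt0 //.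
  apply: (@le_trans _ _ ((t k - t l) * (1 + q))); first nra.
  by rewrite ler_wpM2r ?ler_norm // addr_ge0 // ltW.
have [ij|ij|/val_inj ij] := ltngtP i j; first exact: key.
  by rewrite idistC distrC [t i + _]addrC; exact: key.
by rewrite ij eqxx in ji.
Qed.

(** * Cauchy matrices *)

Lemma size_prod_linear (F : fieldType) (n : nat) (j : 'I_n)
    (g : 'I_n -> {poly F}) :
  (forall l, size (g l) <= 2)%N -> (size (\prod_(l < n | l != j) g l)%R <= n)%N.
Proof.
move=> g2; apply: leq_trans (size_poly_prod_leq _ _) _.
have cE : #|[pred l | l != j]| = n.-1.
  by rewrite (eq_card (B := predC1 j)) // cardC1 card_ord.
have n0 : (0 < n)%N by exact: leq_ltn_trans (ltn_ord j).
rewrite leq_subLR cE.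
have -> : (n.-1 + n = (n.-1 * 2).+1)%N.
  by case: (n) n0 => // m _; rewrite addnS muln2 addnn.
rewrite ltnS.
apply: (@leq_trans (\sum_(l < n | l != j) 2)); first exact: leq_sum.
by rewrite sum_nat_const cE.
Qed.

Lemma lagrange_interpolation (F : fieldType) (n : nat) (t : 'I_n -> F)
    (f : {poly F}) (z : F) :
  injective t -> (size f <= n)%N ->
  f.[z] = \sum_(j < n) f.[t j] * \prod_(l < n | l != j) ((z - t l) / (t j - t l)).
Proof.
move=> tinj fn.
pose g j : {poly F} := \prod_(l < n | l != j) ((t j - t l)^-1 *: ('X - (t l)%:P)).
have gE j x : (g j).[x] = \prod_(l < n | l != j) ((x - t l) / (t j - t l)).
  by rewrite horner_prod; apply: eq_bigr => l _; rewrite !hornerE mulrC.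
pose p := f - \sum_(j < n) f.[t j] *: g j.
have pE x : p.[x] = f.[x] - \sum_(j < n) f.[t j] * (g j).[x].
  by rewrite /p !hornerE horner_sum; congr (_ - _); apply: eq_bigr => j _; rewrite hornerZ.
have gs j : (size (g j) <= n)%N.
  apply: size_prod_linear => l.
  by apply: leq_trans (size_scale_leq _ _) _; rewrite size_XsubC.
have ps : (size p <= n)%N.
  apply: leq_trans (size_polyD _ _) _; rewrite size_polyN geq_max fn /=.
  apply: (big_ind (fun q : {poly F} => (size q <= n)%N)) => [|q r qn rn|j _].
  - by rewrite size_poly0.
  - by apply: leq_trans (size_polyD _ _) _; rewrite geq_max qn.
  - exact: leq_trans (size_scale_leq _ _) (gs j).
have p0 : p = 0.
  apply/eqP; apply: contraT => pN0.
  have := @max_poly_roots _ p (codom t) pN0.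
  rewrite size_codom card_ord ltnNge ps; apply.
    apply/allP => _ /codomP[i ->]; apply/rootP.
    rewrite pE (bigD1 i) //= gE big1; last first.
      move=> l li; rewrite divff // subr_eq0; apply: contra li => /eqP/tinj ->.
      by rewrite eqxx.
    rewrite mulr1 big1 ?addr0 ?subrr // => j ji.
    by rewrite gE (bigD1 i) ?(eq_sym i) //= subrr !mul0r mulr0.
  by rewrite map_inj_uniq ?enum_uniq.
have := pE z; rewrite p0 horner0 => /eqP; rewrite eq_sym subr_eq0 => /eqP ->.
by apply: eq_bigr => j _; rewrite gE.
Qed.

(** Up to the factor [2 t_j], the reciprocal of the Blaschke product of the right
    half-plane with zeros at the other nodes, taken at [t_j]. *)
Definition cauchy_weight (F : fieldType) (n : nat) (t : 'I_n -> F) (j : 'I_n) : F :=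
  2 * t j * \prod_(l < n | l != j) ((t j + t l) / (t j - t l)).

(** The polynomial [prod_(l != k) (X + t_l)] vanishes at [- t_i] unless [i = k];
    Lagrange interpolation at the nodes [t_j] expresses its value at [- t_i] by the
    sum under consideration. *)
Lemma cauchy_inverse (R : realType) (n : nat) (t : 'I_n -> R) (i k : 'I_n) :
  injective t -> (forall j, 0 < t j) ->
  \sum_(j < n) cauchy_weight t j * (t i + t j)^-1 * (t j + t k)^-1
    * cauchy_weight t k = (i == k)%:R.
Proof.
move=> tinj t0.
have s0 a b : t a + t b != 0 by rewrite gt_eqF // addr_gt0.
have d0 a b : a != b -> t a - t b != 0.
  by move=> ab; rewrite subr_eq0; apply: contra ab => /eqP/tinj ->.
pose f : {poly R} := \prod_(l < n | l != k) ('X + (t l)%:P).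
have fE x : f.[x] = \prod_(l < n | l != k) (x + t l).
  by rewrite horner_prod; apply: eq_bigr => l _; rewrite !hornerE.
have fs : (size f <= n)%N by apply: size_prod_linear => l; rewrite size_XaddC.
have neg j (a b : 'I_n -> R) :
    \prod_(l < n | l != j) (- a l * b l)
    = (-1) ^+ n.-1 * \prod_(l < n | l != j) (a l * b l).
  under eq_bigr do rewrite mulNr -mulN1r.
  rewrite big_split /= prodr_const; congr (_ ^+ _ * _).
  by rewrite (eq_card (B := predC1 j)) // cardC1 card_ord.
have fneg : f.[- t i] = (-1) ^+ n.-1 * \prod_(l < n | l != k) (t i - t l).
  rewrite fE; have := neg k (fun l => t i - t l) (fun=> 1).
  under eq_bigr do rewrite mulr1 opprB addrC.
  by move=> ->; congr (_ * _); apply: eq_bigr => l _; rewrite mulr1.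
have negj j : \prod_(l < n | l != j) ((- t i - t l) / (t j - t l))
    = (-1) ^+ n.-1 * \prod_(l < n | l != j) ((t i + t l) / (t j - t l)).
  by rewrite -neg; apply: eq_bigr => l _; congr (_ * _); ring.
pose T x : R := \prod_(l < n) (x + t l).
pose D j : R := \prod_(l < n | l != j) (t j - t l).
have D0 j : D j != 0 by apply/prodf_neq0 => l lj; apply: d0; rewrite eq_sym.
have T0 j : T (t j) != 0 by apply/prodf_neq0 => l _; exact: s0.
have TE a b : \prod_(l < n | l != b) (t a + t l) = T (t a) / (t a + t b).
  by rewrite /T [in RHS](bigD1 b) //= mulrAC divff ?mul1r.
have wE j : cauchy_weight t j = T (t j) / D j.
  rewrite /cauchy_weight prodf_div TE -/(D j); have := s0 j j; have := D0 j.
  have := gt_eqF (t0 j) => /negbT tj0 Dj0 _; field.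
  by rewrite Dj0 -mulr2n mulrn_eq0.
have h : \prod_(l < n | l != k) (t i - t l)
    = (\sum_(j < n) cauchy_weight t j * (t i + t j)^-1 * (t j + t k)^-1) * T (t i).
  apply: (mulfI (negbT (signr_eq0 _ n.-1))).
  rewrite -fneg (lagrange_interpolation _ tinj fs) mulr_suml mulr_sumr.
  apply: eq_bigr => j _; rewrite negj mulrCA; congr (_ * _).
  by rewrite fE wE prodf_div -/(D j) !TE; field; rewrite !s0 D0.
rewrite -mulr_suml; have [ik|ik] := eqVneq i k; last first.
  move: h; rewrite (bigD1 i) //= subrr mul0r => /esym/eqP.
  by rewrite mulf_eq0 (negbTE (T0 i)) orbF => /eqP ->; rewrite mul0r.
by move: h; rewrite wE mulrA ik => <-; rewrite -/(D k) divff.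
Qed.

(** Solving the Cauchy system explicitly serves twice: it bounds the form in
    [cauchy_form_le] and it shows that a nonzero combination of kernels has a
    nonzero value at one of the points ([kernel_nondegenerate]). *)
Lemma cauchy_inversion (R : realType) (n : nat) (t y : 'I_n -> R) (i : 'I_n) :
  injective t -> (forall j, 0 < t j) ->
  y i = \sum_(j < n) cauchy_weight t i * cauchy_weight t j
    * (\sum_(l < n) y l / (t j + t l)) / (t i + t j).
Proof.
move=> tinj t0; pose w := cauchy_weight t.
have inv : (\matrix_(i, j) ((t i + t j)^-1 * w j)) *m
    (\matrix_(i, j) ((t i + t j)^-1 * w j)) = 1%:M :> 'M[R]_n.
  apply/matrixP => a b; rewrite !mxE -(cauchy_inverse a b tinj t0).
  apply: eq_bigr => j _; rewrite !mxE -/w; ring.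
have inv' : (\matrix_(i, j) (w i * (t i + t j)^-1 * w j)) *m
    (\matrix_(i, j) (t i + t j)^-1) = 1%:M :> 'M[R]_n.
  apply: mulmx1C; rewrite -inv; apply/matrixP => a b; rewrite !mxE.
  apply: eq_bigr => j _; rewrite !mxE; ring.
have := congr1 (fun M => (M *m \col_j y j) i 0) inv'.
rewrite mul1mx -mulmxA !mxE => <-; apply: eq_bigr => j _.
rewrite !mxE !mulr_sumr !mulr_suml; apply: eq_bigr => l _; rewrite !mxE -/w; ring.
Qed.

(** Inverting the matrix turns the form in [y] into a form of the same kind in
    the vector [d_i = sum y_j / (t_i + t_j)], whose weights are controlled by the
    separation of the nodes; Schur's test then bounds it. *)
Lemma cauchy_form_le (R : realType) (sigma : R) (n : nat) (t y : 'I_n -> R) :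
  0 < sigma < 1 -> injective t -> (forall i, 0 < t i) -> decays sigma t ->
  \sum_(i < n) \sum_(j < n) y i * y j / (t i + t j)
  <= expR (24 / (1 - sigma)) * (8 / (1 - sigma))
     * \sum_(i < n) 2 * t i * (\sum_(j < n) y j / (t i + t j)) ^+ 2.
Proof.
move=> s01 tinj t0 dec.
pose d i := \sum_(j < n) y j / (t i + t j).
pose w := cauchy_weight t.
have yE i : y i = \sum_(j < n) w i * w j * d j / (t i + t j) := cauchy_inversion y i tinj t0.
have B0 i : 0 < expR (- (12 / (1 - sigma))) by exact: expR_gt0.
have wle i : `|w i| <= expR (12 / (1 - sigma)) * (2 * t i).
  rewrite /w /cauchy_weight normrM ger0_norm ?mulr_ge0 ?(ltW (t0 i)) // mulrC.
  rewrite ler_pM2r ?mulr_gt0 // normr_prod -[leLHS]invrK -prodfV.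
  rewrite -[12 / _]opprK expRN lef_pV2 ?posrE ?expR_gt0 //.
    under eq_bigr => l _ do
      rewrite normf_div invf_div (gtr0_norm (addr_gt0 (t0 i) (t0 l))).
    exact: separation_product_ge.
  apply/prodr_gt0 => l li; rewrite invr_gt0 normr_gt0 mulf_neq0 ?invr_eq0 //.
    by rewrite gt_eqF ?addr_gt0.
  by rewrite subr_eq0; apply: contra li => /eqP/tinj ->.
have sq i : Num.sqrt (t i) * Num.sqrt (t i) = t i.
  by rewrite -expr2 sqr_sqrtr ?ltW.
have -> : expR (24 / (1 - sigma)) = expR (12 / (1 - sigma)) ^+ 2.
  by rewrite expr2 -expRD; congr expR; ring.
set E := expR _ in wle *.
apply: (@le_trans _ _ (E ^+ 2 * 2 * \sum_(i < n) \sum_(j < n)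
    2 * (Num.sqrt (t i) * Num.sqrt (t j)) / (t i + t j)
    * ((Num.sqrt (t i) * `|d i|) * (Num.sqrt (t j) * `|d j|)))).
  rewrite mulr_sumr; apply: ler_sum => i _.
  rewrite (_ : \sum_(j < n) _ = y i * d i); last first.
    by rewrite /d mulr_sumr; apply: eq_bigr => j _; rewrite mulrA.
  rewrite yE mulr_suml mulr_sumr; apply: ler_sum => j _.
  clearbody w d; apply: le_trans (ler_norm _) _.
  rewrite !normrM normfV (gtr0_norm (addr_gt0 (t0 i) (t0 j))).
  rewrite [leRHS](_ : _ = (E * (2 * t i)) * (E * (2 * t j))
    * (`|d i| * `|d j| / (t i + t j))); last first.
    have -> : E * (2 * t i) * (E * (2 * t j)) = E * (2 * (Num.sqrt (t i) * Num.sqrt (t i)))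
      * (E * (2 * (Num.sqrt (t j) * Num.sqrt (t j)))) by rewrite !sq.
    ring.
  rewrite [leLHS](_ : _ = (`|w i| * `|w j|) * (`|d i| * `|d j| / (t i + t j))); last by ring.
  by rewrite ler_pM ?mulr_ge0 ?invr_ge0 ?addr_ge0 ?(ltW (t0 _)) // ler_pM.
apply: (@le_trans _ _ (E ^+ 2 * 2 * (8 / (1 - sigma)
    * \sum_(i < n) (Num.sqrt (t i) * `|d i|) ^+ 2))).
  rewrite ler_wpM2l ?(mulr_ge0 (sqr_ge0 _)) //.
  exact: (schur_test_decays (fun i => Num.sqrt (t i) * `|d i|) s01 t0 dec).
rewrite -mulrA [2 * _]mulrCA !mulrA -mulrA mulr_sumr.
rewrite le_eqVlt; apply/orP; left; apply/eqP; congr (_ * _).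
apply: eq_bigr => i _; rewrite -/(d i) exprMn expr2 sq real_normK ?num_real //.
by rewrite mulrA.
Qed.

(** * Interpolation and Carleson estimates at real points of the disk *)

(** This Moebius map sends the disk onto the right half-plane and turns the Gram
    matrix [1 / (1 - x_i x_j)] into a Cauchy matrix, up to diagonal factors. *)
Definition cayley (R : realType) (x : R) : R := (1 - x) / (1 + x).

Lemma cayley_gt0 (R : realType) (x : R) : -1 < x < 1 -> 0 < cayley x.
Proof. by move=> /andP[? ?]; rewrite divr_gt0 //; lra. Qed.

Lemma decays_injective (R : realType) (sigma : R) (n : nat) (t : 'I_n -> R) :
  0 < sigma < 1 -> (forall i, 0 < t i) -> decays sigma t -> injective t.
Proof.
move=> /andP[s0 s1] t0 dec.
have key (i j : 'I_n) : (i < j)%N -> t i <> t j.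
  move=> ij tij; have := dec i j (ltnW ij); rewrite tij leNgt => /negP; apply.
  by rewrite gtr_pMl // exprn_ilt1 ?(ltW s0) // -lt0n subn_gt0.
move=> i j tij; have [ij|ij|/val_inj //] := ltngtP i j.
  by case: (key _ _ ij).
by case: (key _ _ ij).
Qed.

Lemma cayley_kernelE (R : realType) (x y : R) : -1 < x < 1 -> -1 < y < 1 ->
  (1 - x * y)^-1 = 2 * (1 + x)^-1 * (1 + y)^-1 / (cayley x + cayley y).
Proof.
move=> /andP[x0 x1] /andP[y0 y1].
have px : 1 + x != 0 by rewrite gt_eqF //; lra.
have py : 1 + y != 0 by rewrite gt_eqF //; lra.
have xy : 1 - x * y != 0 by rewrite gt_eqF //; nra.
have -> : cayley x + cayley y = 2 * (1 - x * y) / ((1 + x) * (1 + y)).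
  by rewrite /cayley; field; rewrite px py.
by field; rewrite px py xy.
Qed.

Lemma kernel_nondegenerate (R : realType) (sigma : R) (n : nat) (v y : 'I_n -> R) :
  0 < sigma < 1 -> (forall i, -1 < v i < 1) -> decays sigma (fun i => cayley (v i)) ->
  (forall i, \sum_(j < n) y j / (1 - v i * v j) = 0) -> forall i, y i = 0.
Proof.
move=> s01 v1 dec d0 i; pose t j := cayley (v j).
have t0 j : 0 < t j by exact: cayley_gt0.
have p0 j : 1 + v j != 0 by rewrite gt_eqF //; have := v1 j; lra.
suff : y i / (1 + v i) = 0 by move/eqP; rewrite mulf_eq0 invr_eq0 (negbTE (p0 i)) orbF => /eqP.
rewrite (@cauchy_inversion _ _ t (fun j => y j / (1 + v j)) i
  (decays_injective s01 t0 dec) t0).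
rewrite big1 // => j _; rewrite (_ : \sum_(l < n) _ = 0) ?mulr0 ?mul0r //.
apply: (mulfI (_ : 2 * (1 + v j)^-1 != 0)); first by rewrite mulf_neq0 ?invr_eq0.
rewrite mulr0 -[RHS](d0 j) mulr_sumr; apply: eq_bigr => l _.
by rewrite (cayley_kernelE (v1 j) (v1 l)) -/(t j) -/(t l); ring.
Qed.

(** The left-hand side is the squared norm of [h = sum y_j K_(v_j)] in the Hardy
    space and the inner sums on the right are the values of [h] at the points. *)
Lemma kernel_form_le (R : realType) (sigma : R) (n : nat) (v y : 'I_n -> R) :
  0 < sigma < 1 -> (forall i, -1 < v i < 1) -> decays sigma (fun i => cayley (v i)) ->
  \sum_(i < n) \sum_(j < n) y i * y j / (1 - v i * v j)
  <= expR (24 / (1 - sigma)) * (8 / (1 - sigma))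
     * \sum_(i < n) (1 - v i ^+ 2) * (\sum_(j < n) y j / (1 - v i * v j)) ^+ 2.
Proof.
move=> s01 v1 dec; pose t i := cayley (v i).
have t0 i : 0 < t i by exact: cayley_gt0.
have p0 i : 1 + v i != 0 by rewrite gt_eqF //; have := v1 i; lra.
have tE i j : (1 - v i * v j)^-1 = 2 * (1 + v i)^-1 * (1 + v j)^-1 / (t i + t j).
  exact: cayley_kernelE.
have := cauchy_form_le (fun i => y i / (1 + v i)) s01
  (decays_injective s01 t0 dec) t0 dec.
rewrite -(ler_pM2l (_ : 0 < 2 :> R)) // => h.
apply: le_trans (le_trans h _).
  rewrite le_eqVlt; apply/orP; left; apply/eqP.
  rewrite mulr_sumr; apply: eq_bigr => i _; rewrite mulr_sumr.
  apply: eq_bigr => j _; rewrite tE; ring.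
rewrite le_eqVlt; apply/orP; left; apply/eqP.
rewrite mulrCA; congr (_ * _).
rewrite mulr_sumr; apply: eq_bigr => i _.
have -> : \sum_(j < n) y j / (1 - v i * v j)
    = 2 * (1 + v i)^-1 * \sum_(j < n) y j / (1 + v j) / (t i + t j).
  rewrite mulr_sumr; apply: eq_bigr => j _; rewrite tE; ring.
move: (\sum_(j < n) _) => X.
by rewrite /t /cayley; field; rewrite p0.
Qed.

(** By duality: if [L] denotes the left-hand side and [b] is the image of the
    weighted values under the adjoint map, then [L = sum a_k b_k] while Schur's test
    gives [sum b_k^2 <= C L]; expanding [sum (C a_k - b_k)^2 >= 0] yields
    [L <= C sum a_k^2]. *)
Lemma carleson_embedding (R : realType) (sigma : R) (n : nat) (u : 'I_n -> R)
    (a : nat -> R) (N : nat) :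
  0 < sigma < 1 -> (forall i, 0 <= u i < 1) -> decays sigma (fun i => cayley (u i)) ->
  \sum_(i < n) (1 - u i ^+ 2) * (\sum_(k < N) a k * u i ^+ k) ^+ 2
  <= 8 / (1 - sigma) * \sum_(k < N) a k ^+ 2.
Proof.
move=> s01 u01 dec.
have /andP[s0 s1] := s01.
pose t i := cayley (u i).
have t0 i : 0 < t i by apply: cayley_gt0; have := u01 i; lra.
pose g i := \sum_(k < N) a k * u i ^+ k.
have w0 i : 0 <= 1 - u i ^+ 2 by have /andP[? ?] := u01 i; nra.
pose b k := \sum_(i < n) (1 - u i ^+ 2) * g i * u i ^+ k.
set C := 8 / (1 - sigma).
have C0 : 0 < C by rewrite divr_gt0 // subr_gt0.
set L := \sum_(i < n) _; set A := \sum_(k < N) _.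
have LE : L = \sum_(k < N) a k * b k.
  under [RHS]eq_bigr do rewrite mulr_sumr.
  rewrite exchange_big; apply: eq_bigr => i _ /=.
  by rewrite expr2 mulrA -/(g i) {2}/g mulr_sumr; apply: eq_bigr => k _; ring.
have bb : \sum_(k < N) b k ^+ 2 <= C * L.
  pose y i := Num.sqrt (1 - u i ^+ 2) * `|g i|.
  have -> : L = \sum_(i < n) y i ^+ 2.
    apply: eq_bigr => i _.
    by rewrite /y exprMn sqr_sqrtr // real_normK ?num_real.
  apply: le_trans _ (schur_test_decays y s01 t0 dec).
  have -> : \sum_(k < N) b k ^+ 2 = \sum_(i < n) \sum_(j < n)
     (1 - u i ^+ 2) * g i * ((1 - u j ^+ 2) * g j) * \sum_(k < N) (u i * u j) ^+ k.
    under eq_bigr => k _ do rewrite expr2 /b mulr_suml.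
    rewrite exchange_big; apply: eq_bigr => i _ /=.
    under eq_bigr => k _ do rewrite mulr_sumr.
    rewrite exchange_big; apply: eq_bigr => j _ /=.
    by rewrite [RHS]mulr_sumr; apply: eq_bigr => k _; rewrite exprMn; ring.
  apply: ler_sum => i _; apply: ler_sum => j _.
  have /andP[ui0 ui1] := u01 i; have /andP[uj0 uj1] := u01 j.
  have uij : u i * u j < 1 by nra.
  have uij0 : 0 <= u i * u j by rewrite mulr_ge0.
  have S0 : 0 <= \sum_(k < N) (u i * u j) ^+ k.
    by apply: sumr_ge0 => k _; rewrite exprn_ge0.
  apply: le_trans (ler_norm _) _; rewrite !normrM (ger0_norm S0) !(ger0_norm (w0 _)).
  apply: le_trans (ler_wpM2l _ (sum_geometric_le N uij0 uij)) _.
    by rewrite !mulr_ge0.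
  have sq (k : 'I_n) : Num.sqrt (t k) = Num.sqrt (1 - u k ^+ 2) / (1 + u k).
    have /andP[uk0 uk1] := u01 k; have pk : 0 < 1 + u k by lra.
    have -> : t k = (1 - u k ^+ 2) * ((1 + u k)^-1) ^+ 2.
      by rewrite /t /cayley; field; rewrite gt_eqF.
    by rewrite sqrtrM // sqrtr_sqr ger0_norm // invr_ge0 ltW.
  have e : t i + t j = 2 * (1 - u i * u j) / ((1 + u i) * (1 + u j)).
    by rewrite /t /cayley; field; rewrite !gt_eqF //; lra.
  rewrite -/(t i) -/(t j) !sq e.
  rewrite le_eqVlt; apply/orP; left; apply/eqP; rewrite /y.
  rewrite -[in LHS](sqr_sqrtr (w0 i)) -[in LHS](sqr_sqrtr (w0 j)).
  by field; rewrite !gt_eqF //; lra.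
have : 0 <= \sum_(k < N) (C * a k - b k) ^+ 2.
  by apply: sumr_ge0 => k _; rewrite sqr_ge0.
have -> : \sum_(k < N) (C * a k - b k) ^+ 2
    = C ^+ 2 * A - 2 * C * L + \sum_(k < N) b k ^+ 2.
  rewrite LE /A !mulr_sumr -sumrB -big_split /=.
  by apply: eq_bigr => k _; ring.
move=> pos; rewrite -(ler_pM2l C0); clearbody L A C; nra.
Qed.

Lemma cvg_sum (K : numFieldType) (V : normedModType K) (I T : Type)
    (F : set_system T) (r : seq I) (f : I -> T -> V) (a : I -> V) :
  Filter F -> (forall i, f i x @[x --> F] --> a i) ->
  \sum_(i <- r) f i x @[x --> F] --> \sum_(i <- r) a i.
Proof. by move=> FF fa; apply: cvg_big => //; exact: add_continuous. Qed.

(** The right-hand side is the sum of the whole series whose partial sums are on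
    the left. *)
Lemma kernel_coef_le (R : realType) (n : nat) (v y : 'I_n -> R) (N : nat) :
  (forall i, -1 < v i < 1) ->
  \sum_(k < N) (\sum_(j < n) y j * v j ^+ k) ^+ 2
  <= \sum_(i < n) \sum_(j < n) y i * y j / (1 - v i * v j).
Proof.
move=> v1.
have vv i j : `|v i * v j| < 1.
  rewrite normrM; apply: mulr_ilt1 => //; rewrite ltr_norml; exact: v1.
have d0 i j : 1 - v i * v j != 0.
  by rewrite gt_eqF // subr_gt0 (le_lt_trans (ler_norm _)).
have E M : \sum_(k < M) (\sum_(j < n) y j * v j ^+ k) ^+ 2
  = \sum_(i < n) \sum_(j < n) (y i * y j / (1 - v i * v j)
     - y i * y j / (1 - v i * v j) * (v i * v j) ^+ M).
  under eq_bigr => k _ do rewrite expr2 mulr_suml.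
  rewrite exchange_big; apply: eq_bigr => i _ /=.
  under eq_bigr => k _ do rewrite mulr_sumr.
  rewrite exchange_big; apply: eq_bigr => j _ /=.
  rewrite (eq_bigr (fun k : 'I_M => y i * y j * (v i * v j) ^+ k)); last first.
    by move=> k _; rewrite exprMn; ring.
  rewrite -mulr_sumr.
  have -> : \sum_(k < M) (v i * v j) ^+ k = (1 - (v i * v j) ^+ M) / (1 - v i * v j).
    apply: (mulfI (d0 i j)); rewrite [RHS]mulrCA divff // mulr1.
    by rewrite -[1 - v i * v j]opprB mulNr -subrX1 opprB.
  ring.
have lim : \sum_(k < M) (\sum_(j < n) y j * v j ^+ k) ^+ 2 @[M --> \oo]
    --> \sum_(i < n) \sum_(j < n) (y i * y j / (1 - v i * v j) - 0).
  under eq_fun do rewrite E.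
  apply: cvg_sum => i; apply: cvg_sum => j; apply: cvgB; first exact: cvg_cst.
  exact: cvg_geometric.
under [leRHS]eq_bigr do under eq_bigr do rewrite -[_ / _]subr0.
apply: (cvgr_to_ge lim); exists N => // M /= NM.
rewrite -(subnKC NM) big_split_ord /= lerDl sumr_ge0 // => k _; exact: sqr_ge0.
Qed.

(** * Averages over roots of unity *)

Lemma Re_sum (R : realType) (I : Type) (r : seq I) (P : pred I) (F : I -> R[i]) :
  complex.Re (\sum_(i <- r | P i) F i) = \sum_(i <- r | P i) complex.Re (F i).
Proof. by apply: big_morph => // -[? ?] [? ?]. Qed.

Lemma Re_add (R : realType) (x y : R[i]) :
  complex.Re (x + y) = complex.Re x + complex.Re y.
Proof. by case: x y => [? ?] [? ?]. Qed.

Lemma Im_sum (R : realType) (I : Type) (r : seq I) (P : pred I) (F : I -> R[i]) :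
  complex.Im (\sum_(i <- r | P i) F i) = \sum_(i <- r | P i) complex.Im (F i).
Proof. by apply: big_morph => // -[? ?] [? ?]. Qed.

Lemma Re_scale (R : realType) (a : R) (z : R[i]) :
  complex.Re (a%:C%C * z) = a * complex.Re z.
Proof. by case: z => x y /=; rewrite mul0r subr0. Qed.

Lemma Im_scale (R : realType) (a : R) (z : R[i]) :
  complex.Im (a%:C%C * z) = a * complex.Im z.
Proof. by case: z => x y /=; rewrite mul0r addr0. Qed.

Lemma prim_root_exists (R : realType) (n : nat) : (0 < n)%N ->
  exists z : R[i], n.-primitive_root z.
Proof.
move=> n_gt0; pose p : {poly R[i]} := 'X^n - 1.
have [r Dp] := closed_field_poly_normal p.
rewrite (monicP _) ?monicXnsubC // scale1r in Dp.
have rn1 : all n.-unity_root r by apply/allP => z; rewrite -root_prod_XsubC -Dp.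
have sz_r : (n < (size r).+1)%N.
  by rewrite -(size_prod_XsubC r id) -Dp size_XnsubC.
have [|z] := hasP (has_prim_root n_gt0 rn1 _ sz_r); last by exists z.
by rewrite -separable_prod_XsubC -Dp separable_Xn_sub_1 // pnatr_eq0 -lt0n.
Qed.

(** The right-hand side is twice the mean over the circle of the product of the
    two nonnegative functions [Re p] and [Re q]. The mean over the roots of unity
    of order [2 (N + 1)] has the same value, because [p q] and [conj p q] only
    involve exponents of absolute value smaller than this order. *)
Lemma trigonometric_pairing_ge0 (R : realType) (N : nat) (al : nat -> R)
    (be : nat -> R[i]) :
  (forall z : R[i], `|z| = 1 -> 0 <= complex.Re (\sum_(k < N.+1) (al k)%:C%C * z ^+ k)) ->
  (forall z : R[i], `|z| = 1 -> 0 <= complex.Re (\sum_(k < N.+1) be k * z ^+ k)) ->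
  0 <= al 0%N * complex.Re (be 0%N) + \sum_(k < N.+1) al k * complex.Re (be k).
Proof.
move=> p_ge0 q_ge0; set M := (N.+1 * 2)%N.
have [z zM] : exists z : R[i], M.-primitive_root z by exact: prim_root_exists.
have z1 : `|z| = 1.
  apply/eqP; rewrite -(@pexpr_eq1 _ _ M) ?muln_gt0 //.
  by rewrite -normrX (prim_expr_order zM) normr1.
have zJ : conjc z * z = 1.
  have := add_Re2_Im2 z; rewrite z1 expr1n; case: (z) => a b /=.
  by move=> [e]; apply/eqP; rewrite eq_complex /= -e; apply/andP; split; apply/eqP; ring.
pose T m := \sum_(t < M) (z ^+ t) ^+ m.
have T0 m : (0 < m < M)%N -> T m = 0.
  move=> /andP[m0 mM].
  have zm1 : z ^+ m != 1 by rewrite -(prim_order_dvd zM) gtnNdvd.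
  apply: (mulfI (_ : z ^+ m - 1 != 0)); first by rewrite subr_eq0.
  rewrite mulr0 /T; under eq_bigr do rewrite exprAC.
  by rewrite -subrX1 exprAC (prim_expr_order zM) expr1n subrr.
have TJ k l : \sum_(t < M) conjc (z ^+ t) ^+ k * (z ^+ t) ^+ l
    = if (k <= l)%N then T (l - k)%N else conjc (T (k - l)%N).
  have tJ t : conjc (z ^+ t) * z ^+ t = 1 by rewrite rmorphXn -exprMn zJ expr1n.
  case: leqP => kl.
    apply: eq_bigr => t _; rewrite -{1}(subnKC kl) exprD mulrA -exprMn tJ.
    by rewrite expr1n mul1r.
  rewrite rmorph_sum; apply: eq_bigr => t _.
  rewrite -{1}(subnK (ltnW kl)) exprD -mulrA -exprMn tJ expr1n mulr1.
  by rewrite !rmorphXn.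
pose p (x : R[i]) := \sum_(k < N.+1) (al k)%:C%C * x ^+ k.
pose q (x : R[i]) := \sum_(k < N.+1) be k * x ^+ k.
have ReRe (a b : R[i]) : complex.Re a * complex.Re b * 2
    = complex.Re (a * b + conjc a * b).
  by case: a b => [a1 a2] [b1 b2] /=; ring.
have sumpq : \sum_(t < M) p (z ^+ t) * q (z ^+ t)
    = M%:R * ((al 0%N)%:C%C * be 0%N).
  have -> : \sum_(t < M) p (z ^+ t) * q (z ^+ t) = \sum_(k < N.+1)
      \sum_(l < N.+1) (al k)%:C%C * be l * T (k + l)%N.
    under eq_bigr do rewrite /p mulr_suml; rewrite exchange_big.
    apply: eq_bigr => k _; under eq_bigr do rewrite /q mulr_sumr.
    rewrite exchange_big; apply: eq_bigr => l _; rewrite mulr_sumr.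
    by apply: eq_bigr => t _; rewrite exprD; ring.
  have T00 : T 0%N = M%:R.
    by rewrite /T; under eq_bigr do rewrite expr0; rewrite sumr_const card_ord.
  have kl0 (k l : 'I_N.+1) : (0 < k + l)%N -> T (k + l)%N = 0.
    by move=> kl; apply: T0; rewrite kl /= /M muln2 -addnn -addSn leq_add // ltnW.
  rewrite big_ord_recl [X in _ + X]big1; last first.
    by move=> k _; rewrite big1 // => l _; rewrite kl0 ?mulr0.
  rewrite big_ord_recl [X in _ + X + _]big1; last first.
    by move=> l _; rewrite kl0 ?mulr0.
  by rewrite /= T00 !addr0 mulrC.
have sumpJq : \sum_(t < M) conjc (p (z ^+ t)) * q (z ^+ t)
    = M%:R * \sum_(k < N.+1) (al k)%:C%C * be k.
  have -> : \sum_(t < M) conjc (p (z ^+ t)) * q (z ^+ t) = \sum_(k < N.+1)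
      \sum_(l < N.+1) (al k)%:C%C * be l
        * (\sum_(t < M) conjc (z ^+ t) ^+ k * (z ^+ t) ^+ l).
    under eq_bigr do rewrite /p rmorph_sum mulr_suml; rewrite exchange_big.
    apply: eq_bigr => k _; under eq_bigr do rewrite /q mulr_sumr.
    rewrite exchange_big; apply: eq_bigr => l _; rewrite mulr_sumr.
    apply: eq_bigr => t _; rewrite rmorphM rmorphXn.
    transitivity ((al k)%:C%C * conjc (z ^+ t) ^+ k * (be l * z ^+ t ^+ l)); last by ring.
    by congr (_ * _ * _); exact: conjc_real.
  have T00 : T 0%N = M%:R.
    by rewrite /T; under eq_bigr do rewrite expr0; rewrite sumr_const card_ord.
  rewrite mulr_sumr; apply: eq_bigr => k _.
  rewrite (bigD1 k) // TJ leqnn subnn T00 big1; first by rewrite /= addr0 mulrC.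
  move=> l lk.
  have sM (m m' : 'I_N.+1) : (m - m' < M)%N.
    apply: leq_ltn_trans (leq_subr _ _) _.
    by apply: leq_trans (ltn_ord m) _; rewrite leq_pmulr.
  rewrite TJ; case: leqP => kl; rewrite T0 ?rmorph0 ?mulr0 // sM andbT subn_gt0 //.
  by rewrite ltn_neqAle kl andbT eq_sym.
have : 0 <= \sum_(t < M) complex.Re (p (z ^+ t)) * complex.Re (q (z ^+ t)) * 2.
  apply: sumr_ge0 => t _; rewrite !mulr_ge0 //.
    by apply: p_ge0; rewrite normrX z1 expr1n.
  by apply: q_ge0; rewrite normrX z1 expr1n.
under eq_bigr do rewrite ReRe.
rewrite -Re_sum big_split /= sumpq sumpJq -mulrDr -(rmorph_nat (real_complex R)).
rewrite Re_scale pmulr_rge0 ?ltr0n //.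
rewrite Re_add Re_scale Re_sum => h; apply: le_trans h _; rewrite lerD2l.
by apply: ler_sum => k _; rewrite Re_scale.
Qed.

(** * Harnack's inequality for power series *)

Local Notation normc := Normc.normc.

Lemma normc_ge0 (R : realType) (z : R[i]) : 0 <= normc z.
Proof. by case: z => x y; exact: sqrtr_ge0. Qed.

Lemma ler_normcD (R : realType) (x y : R[i]) :
  normc (x + y) <= normc x + normc y.
Proof. exact: le_normcD. Qed.

Lemma normcX (R : realType) (z : R[i]) (n : nat) : normc (z ^+ n) = normc z ^+ n.
Proof.
elim: n => [|n IH]; first by rewrite !expr0 Normc.normc1.
by rewrite !exprS Normc.normcM IH.
Qed.

Lemma normc_real (R : realType) (x : R) : normc x%:C%C = `|x|.
Proof. by rewrite /= expr0n addr0 sqrtr_sqr. Qed.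

Lemma normc_sqr (R : realType) (z : R[i]) :
  normc z ^+ 2 = complex.Re z ^+ 2 + complex.Im z ^+ 2.
Proof. by case: z => x y /=; rewrite sqr_sqrtr // addr_ge0 ?sqr_ge0. Qed.

Lemma Re_le_normc (R : realType) (z : R[i]) : `|complex.Re z| <= normc z.
Proof. by rewrite -lecR; exact: normc_ge_Re. Qed.

Lemma normc_sum (R : realType) (I : Type) (r : seq I) (P : pred I) (F : I -> R[i]) :
  normc (\sum_(i <- r | P i) F i) <= \sum_(i <- r | P i) normc (F i).
Proof.
elim/big_rec2: _ => [|i x y _ IH]; first by rewrite Normc.normc0.
by apply: le_trans (ler_normcD _ _) _; rewrite lerD2l.
Qed.

Lemma normc1B_ge (R : realType) (q : R[i]) : 1 - normc q <= normc (1 - q).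
Proof.
rewrite lerBlDr; apply: le_trans (ler_normcD _ _).
by rewrite subrK Normc.normc1.
Qed.

Lemma geometric_sum_Re (R : realType) (q : R[i]) (N : nat) (r : R) :
  normc q = r -> r < 1 ->
  `|complex.Re (\sum_(k < N) q ^+ k) - complex.Re (1 - q)^-1| <= r ^+ N / (1 - r).
Proof.
move=> qr r1; have r0 : 0 <= r by rewrite -qr normc_ge0.
have d0 : 0 < 1 - r by rewrite subr_gt0.
have nq : 1 - r <= normc (1 - q) by rewrite -qr normc1B_ge.
have q0 : 1 - q != 0.
  by apply: contraTneq nq => ->; rewrite Normc.normc0 leNgt d0.
have e : \sum_(k < N) q ^+ k = (1 - q)^-1 + - (q ^+ N / (1 - q)).
  apply: (mulfI q0); rewrite mulrDr mulrN [_ * (_ / _)]mulrC mulfVK // divff //.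
  by rewrite -[in LHS]opprB mulNr -subrX1 opprB.
rewrite e Re_add addrAC subrr add0r; apply: le_trans (Re_le_normc _) _.
rewrite normcN Normc.normcM Normc.normcV normcX qr.
by rewrite ler_wpM2l ?exprn_ge0 // lef_pV2 ?posrE // (lt_le_trans d0).
Qed.

Lemma poisson_denominator_gt0 (R : realType) (x c : R) : 0 <= x < 1 -> c <= 1 ->
  0 < 1 - 2 * x * c + x ^+ 2.
Proof.
move=> /andP[x0 x1] c1; rewrite (_ : _ + _ = (1 - x) ^+ 2 + 2 * (x * (1 - c))).
  by rewrite ltr_pwDl ?exprn_gt0 ?subr_gt0 // !mulr_ge0 // subr_ge0.
ring.
Qed.

Lemma poisson_kernelE (R : realType) (x : R) (z : R[i]) : normc z = 1 -> 0 <= x < 1 ->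
  complex.Re (1 - x%:C%C * z)^-1 * 2 - 1
  = (1 - x ^+ 2) / (1 - 2 * x * complex.Re z + x ^+ 2).
Proof.
case: z => c s nz /andP[x0 x1]; have := normc_sqr (c +i* s)%C.
rewrite nz expr1n /= => e.
have d0 : 1 - 2 * x * c + x ^+ 2 != 0 by rewrite gt_eqF // poisson_denominator_gt0 ?x0 //; nra.
rewrite mul0r subr0 mul0r addr0.
have -> : (1 - x * c) ^+ 2 + (0 - x * s) ^+ 2 = 1 - 2 * x * c + x ^+ 2.
  rewrite (_ : _ + _ = 1 - 2 * x * c + x ^+ 2 * (c ^+ 2 + s ^+ 2)); last by ring.
  by rewrite -e mulr1.
by field.
Qed.

(** After multiplication by the denominators the difference is a nonnegative
    multiple of [1 + Re z]: the ratio of the two Poisson kernels is extremal at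
    [z = -1]. *)
Lemma poisson_kernel_compare (R : realType) (u w : R) (z : R[i]) :
  normc z = 1 -> 0 <= u -> u < w -> w < 1 ->
  cayley w * (complex.Re (1 - u%:C%C * z)^-1 * 2 - 1)
  <= cayley u * (complex.Re (1 - w%:C%C * z)^-1 * 2 - 1).
Proof.
move=> nz u0 uw w1.
rewrite !poisson_kernelE //; [|lra|lra].
have e := normc_sqr z; rewrite nz expr1n in e.
set c := complex.Re z in e *.
have c1 : -1 <= c <= 1 by nra.
have /andP[c0 c1'] := c1.
have du : 0 < 1 - 2 * u * c + u ^+ 2 by apply: poisson_denominator_gt0 => //; lra.
have dw : 0 < 1 - 2 * w * c + w ^+ 2 by apply: poisson_denominator_gt0 => //; lra.
rewrite /cayley -subr_ge0.
rewrite (_ : _ - _ = 2 * (1 - u) * (1 - w) * (1 + c) * (w - u) * (1 - u * w)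
   / ((1 + u) * (1 + w) * (1 - 2 * u * c + u ^+ 2) * (1 - 2 * w * c + w ^+ 2))).
  rewrite divr_ge0 // !mulr_ge0 //; nra.
by field; rewrite !gt_eqF //; lra.
Qed.

Lemma Re_opp (R : realType) (z : R[i]) : complex.Re (- z) = - complex.Re z.
Proof. by case: z. Qed.

Lemma power_series_tail (R : realType) (b : nat -> R[i]) (B r : R) (z : R[i])
    (N m : nat) :
  (forall k, normc (b k) <= B) -> normc z = r -> r < 1 ->
  complex.Re (\sum_(k < N) b k * z ^+ k)
  <= complex.Re (\sum_(k < N + m) b k * z ^+ k) + B * r ^+ N / (1 - r).
Proof.
move=> bB zr r1; have r0 : 0 <= r by rewrite -zr normc_ge0.
have B0 : 0 <= B by apply: le_trans (bB 0%N); exact: normc_ge0.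
rewrite big_split_ord /= Re_add -addrA lerDl.
have : `|complex.Re (\sum_(i < m) b (N + i)%N * z ^+ (N + i))|
    <= B * r ^+ N / (1 - r).
  apply: le_trans (Re_le_normc _) _; apply: le_trans (normc_sum _ _ _) _.
  apply: (@le_trans _ _ (\sum_(i < m) B * r ^+ N * r ^+ i)).
    apply: ler_sum => i _; rewrite Normc.normcM normcX zr exprD -mulrA.
    by rewrite ler_wpM2r // mulr_ge0 ?exprn_ge0.
  rewrite -mulr_sumr ler_wpM2l ?mulr_ge0 ?exprn_ge0 //.
  exact: sum_geometric_le.
by rewrite ler_norml => /andP[h _]; rewrite -lerBlDr sub0r.
Qed.

(** The difference of the multiplied Poisson kernels at [w] and [u] is
    nonnegative on the circle, and so is [1 - F] on the circle of radius [r]. Their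
    truncations are nonnegative up to errors [ep] and [ep'] that tend to 0, so that
    [trigonometric_pairing_ge0] applies to them; the limit of its conclusion is the
    desired inequality. *)
Lemma harnack_dilated (R : realType) (b : nat -> R[i]) (B : R) (F : R[i] -> R)
    (u w r : R) :
  (forall k, normc (b k) <= B) ->
  (forall z, normc z < 1 ->
    (fun N => complex.Re (\sum_(k < N) b k * z ^+ k)) @ \oo --> F z) ->
  (forall z, normc z < 1 -> F z <= 1) ->
  0 <= u -> u < w -> w < 1 -> 0 <= r < 1 ->
  cayley w * (1 - F (r * u)%:C%C) <= cayley u * (1 - F (r * w)%:C%C).
Proof.
move=> bB hF F1 u0 uw w1 /andP[r0 r1].
have w0 : 0 < w := le_lt_trans u0 uw.
have u1 : u < 1 := lt_trans uw w1.
have cw0 : 0 < cayley w by apply: cayley_gt0; lra.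
have cu0 : 0 < cayley u by apply: cayley_gt0; lra.
pose S N (z : R[i]) := complex.Re (\sum_(k < N) b k * z ^+ k).
pose ep N := 2 * cayley u * (w ^+ N / (1 - w)) + 2 * cayley w * (u ^+ N / (1 - u)).
pose ep' N := B * r ^+ N / (1 - r).
pose b0 := complex.Re (b 0%N).
have pos N : 0 <= cayley u * (1 - S N.+1 (r * w)%:C%C)
    - cayley w * (1 - S N.+1 (r * u)%:C%C)
    + ep N.+1 * (1 - b0 + ep' N.+1) + (cayley u - cayley w) * ep' N.+1.
  (* coefficients of the truncated kernels plus [ep] and of [1 - F] plus [ep'];
     the constant term of a Poisson kernel is 1 instead of 2 *)
  pose al k : R := 2 * (cayley u * w ^+ k - cayley w * u ^+ k)
    - (k == 0%N)%:R * (cayley u - cayley w - ep N.+1).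
  pose be k : R[i] := (k == 0%N)%:R * (1 + ep' N.+1)%:C%C - b k * r%:C%C ^+ k.
  have alE (z : R[i]) : complex.Re (\sum_(k < N.+1) (al k)%:C%C * z ^+ k) =
      cayley u * (complex.Re (\sum_(k < N.+1) (w%:C%C * z) ^+ k) * 2 - 1)
      - cayley w * (complex.Re (\sum_(k < N.+1) (u%:C%C * z) ^+ k) * 2 - 1)
      + ep N.+1.
    rewrite !Re_sum !big_ord_recl !expr0 Re_scale.
    have e (x : R) : \sum_(k < N) complex.Re ((x%:C%C * z) ^+ lift ord0 k)
        = \sum_(k < N) x ^+ k.+1 * complex.Re (z ^+ k.+1).
      by apply: eq_bigr => k _; rewrite exprMn -rmorphXn Re_scale.
    rewrite !e; have -> : \sum_(k < N) complex.Re ((al (lift ord0 k))%:C%C * z ^+ lift ord0 k)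
        = 2 * cayley u * \sum_(k < N) w ^+ k.+1 * complex.Re (z ^+ k.+1)
        - 2 * cayley w * \sum_(k < N) u ^+ k.+1 * complex.Re (z ^+ k.+1).
      rewrite !mulr_sumr -sumrB; apply: eq_bigr => k _.
      by rewrite Re_scale /al /= /bump /= add1n; ring.
    rewrite /al /=; ring.
  have beE (z : R[i]) : complex.Re (\sum_(k < N.+1) be k * z ^+ k) =
      1 + ep' N.+1 - S N.+1 (r%:C%C * z).
    rewrite /S !Re_sum !big_ord_recl /= /be !expr0 !mulr1 mul1r.
    rewrite (_ : \sum_(i < N) complex.Re (_ * z ^+ lift ord0 i) =
      - \sum_(i < N) complex.Re (b (lift ord0 i) * (r%:C%C * z) ^+ lift ord0 i)).
      by rewrite Re_add Re_opp /=; ring.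
    rewrite -sumrN; apply: eq_bigr => k _; rewrite -Re_opp; congr complex.Re.
    by rewrite mul0r exprMn; ring.
  have p_ge0 (z : R[i]) : `|z| = 1 ->
      0 <= complex.Re (\sum_(k < N.+1) (al k)%:C%C * z ^+ k).
    move=> z1; have nz : normc z = 1 by apply: complexI.
    rewrite alE.
    have nx x : 0 <= x -> normc (x%:C%C * z) = x.
      by move=> x0; rewrite Normc.normcM nz mulr1 normc_real ger0_norm.
    have := poisson_kernel_compare nz u0 uw w1.
    have := geometric_sum_Re N.+1 (nx _ u0) u1.
    have := geometric_sum_Re N.+1 (nx _ (ltW w0)) w1.
    rewrite !ler_norml /ep => /andP[h1 _] /andP[_ h2] h3.
    have := ler_wpM2l (ltW cu0) h1; have := ler_wpM2l (ltW cw0) h2.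
    move: h3; lra.
  have q_ge0 (z : R[i]) : `|z| = 1 ->
      0 <= complex.Re (\sum_(k < N.+1) be k * z ^+ k).
    move=> z1; have nz : normc z = 1 by apply: complexI.
    have nr : normc (r%:C%C * z) = r.
      by rewrite Normc.normcM nz mulr1 normc_real ger0_norm.
    have nr1 : normc (r%:C%C * z) < 1 by rewrite nr.
    have h := F1 _ nr1; rewrite beE.
    suff : S N.+1 (r%:C%C * z) <= F (r%:C%C * z) + ep' N.+1 by move: h; lra.
    rewrite -lerBlDr; apply: (cvgr_to_ge (hF _ nr1)).
    exists N.+1 => // M /= NM; rewrite lerBlDr -(subnKC NM).
    exact: power_series_tail.
  have := trigonometric_pairing_ge0 p_ge0 q_ge0.
  have e (x : R) : S N.+1 (r * x)%:C%C
      = b0 + \sum_(k < N) x ^+ k.+1 * complex.Re (b k.+1 * r%:C%C ^+ k.+1).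
    rewrite /S Re_sum big_ord_recl expr0 mulr1; congr (_ + _).
    apply: eq_bigr => k _; rewrite -Re_scale; congr complex.Re.
    by rewrite lift0 rmorphM exprMn rmorphXn /=; ring.
  rewrite !e big_ord_recl /al /be /= !expr0 mulr1 mul1r Re_add Re_opp /= -/b0.
  rewrite (_ : \sum_(i < N) _ = \sum_(i < N)
    (2 * cayley w * (u ^+ i.+1 * complex.Re (b i.+1 * r%:C%C ^+ i.+1))
    - 2 * cayley u * (w ^+ i.+1 * complex.Re (b i.+1 * r%:C%C ^+ i.+1)))).
    rewrite sumrB -!mulr_sumr => h; rewrite -(pmulr_rge0 _ (_ : 0 < 2 :> R)) //.
    apply: le_trans h _; rewrite le_eqVlt; apply/orP; left; apply/eqP.
    by rewrite [b 0%N * 1]mulr1 -/b0; ring.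
  by apply: eq_bigr => k _; rewrite mul0r Re_add Re_opp /= /bump /= add1n; ring.
have n1 x : 0 <= x -> x < 1 -> normc (r * x)%:C%C < 1.
  move=> x0 x1; rewrite normc_real ger0_norm ?mulr_ge0 //.
  by apply: le_lt_trans r1; rewrite ler_piMr // ltW.
have hw := hF _ (n1 _ (ltW w0) w1); have hu := hF _ (n1 _ u0 u1).
have gX a x : 0 <= x -> x < 1 -> (fun N : nat => a * x ^+ N) @ \oo --> (0 : R).
  by move=> x0 x1; apply: cvg_geometric; rewrite ger0_norm.
have epE N : ep N = 2 * cayley u / (1 - w) * w ^+ N + 2 * cayley w / (1 - u) * u ^+ N.
  by rewrite /ep; ring.
have ep0 : ep N @[N --> \oo] --> (0 : R).
  rewrite -[X in _ --> X]addr0; under eq_fun do rewrite epE.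
  by apply: cvgD; apply: gX => //; exact: ltW.
have ep'0 : ep' N @[N --> \oo] --> (0 : R).
  by rewrite /ep'; under eq_fun do rewrite mulrAC; exact: gX.
have lim : cayley u * (1 - S N (r * w)%:C%C) - cayley w * (1 - S N (r * u)%:C%C)
    + ep N * (1 - b0 + ep' N) + (cayley u - cayley w) * ep' N @[N --> \oo] -->
    cayley u * (1 - F (r * w)%:C%C) - cayley w * (1 - F (r * u)%:C%C)
    + 0 * (1 - b0 + 0) + (cayley u - cayley w) * 0.
  apply: cvgD; last exact: cvgMl_tmp.
  apply: cvgD; last by apply: cvgM => //; apply: cvgD => //; exact: cvg_cst.
  by apply: cvgB; apply: cvgMl_tmp; apply: cvgB => //; exact: cvg_cst.
rewrite -subr_ge0.
have := @cvgr_to_ge _ _ _ _ _ _ 0 lim.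
rewrite mul0r mulr0 !addr0; apply.
by exists 1%N => // -[//|N] _; exact: pos.
Qed.

(** The points [u / r] and [w / r] of the dilated inequality are legitimate for
    [w < r < 1], and [r] tends to 1. *)
Lemma harnack (R : realType) (b : nat -> R[i]) (B : R) (F : R[i] -> R)
    (u w : R) :
  (forall k, normc (b k) <= B) ->
  (forall z, normc z < 1 ->
    (fun N => complex.Re (\sum_(k < N) b k * z ^+ k)) @ \oo --> F z) ->
  (forall z, normc z < 1 -> F z <= 1) ->
  0 <= u -> u < w -> w < 1 ->
  cayley w * (1 - F u%:C%C) <= cayley u * (1 - F w%:C%C).
Proof.
move=> bB hF F1 u0 uw w1; have w0 : 0 < w := le_lt_trans u0 uw.
set p := 1 - F u%:C%C; set q := 1 - F w%:C%C.
(* the dilated inequality cleared of its denominators *)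
pose f (r : R) := (r - u) * (r + w) * q - (r - w) * (r + u) * p.
have f_ge0 r : w < r -> r < 1 -> 0 <= f r.
  move=> wr r1; have r0 : 0 < r := lt_trans w0 wr.
  have ur0 : 0 <= u / r by rewrite divr_ge0 // ltW.
  have uwr : u / r < w / r by rewrite ltr_pM2r ?invr_gt0.
  have wr1 : w / r < 1 by rewrite ltr_pdivrMr // mul1r.
  have r01 : 0 <= r < 1 by rewrite ltW.
  have := harnack_dilated bB hF F1 ur0 uwr wr1 r01.
  rewrite !(mulrC r) !divfK ?gt_eqF //.
  have E x : 0 <= x -> cayley (x / r) = (r - x) / (r + x).
    by move=> x0; rewrite /cayley; field; rewrite !gt_eqF //; lra.
  rewrite !E ?(ltW w0) // -/p -/q -subr_ge0 => h.
  have -> : f r = ((r - u) / (r + u) * q - (r - w) / (r + w) * p) * ((r + u) * (r + w)).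
    by rewrite /f; field; rewrite !gt_eqF //; lra.
  by rewrite mulr_ge0 // mulr_ge0; lra.
have f1 : 0 <= f 1.
  have fc : f x @[x --> (1 : R)^'-] --> f 1.
    apply: cvg_at_left_filter; rewrite /f.
    by apply: cvgB; apply: cvgMr_tmp; apply: cvgM; (apply: cvgB || apply: cvgD);
      (exact: cvg_cst || exact: cvg_id).
  apply: (cvgr_to_ge fc); near=> r.
  by apply: f_ge0; near: r; [exact: nbhs_left_gt | exact: nbhs_left_lt].
rewrite -subr_ge0.
have -> : cayley u * q - cayley w * p = f 1 / ((1 + u) * (1 + w)).
  by rewrite /f /cayley; field; rewrite !gt_eqF //; lra.
by rewrite divr_ge0 // mulr_ge0; lra.
Unshelve. all: by end_near.
Qed.

(** * Kernel functions in the Hardy space *)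

Lemma cvg_Re (R : realType) (s : nat -> R[i]^o) (l : R[i]^o) :
  s @ \oo --> l -> (fun N => complex.Re (s N)) @ \oo --> complex.Re l.
Proof.
move=> /cvgrPdist_lt sl; apply/cvgrPdist_lt => e e0.
have e0' : 0 < e%:C%C by rewrite ltcR.
have := sl _ e0'; apply: filterS => N /= h.
have -> : complex.Re l - complex.Re (s N) = complex.Re (l - s N).
  by rewrite Re_add Re_opp.
by apply: le_lt_trans (Re_le_normc _) _; rewrite -ltcR.
Qed.

Lemma Im_add (R : realType) (x y : R[i]) :
  complex.Im (x + y) = complex.Im x + complex.Im y.
Proof. by case: x y => [? ?] [? ?]. Qed.

Lemma Im_opp (R : realType) (z : R[i]) : complex.Im (- z) = - complex.Im z.
Proof. by case: z. Qed.

Lemma Im_le_normc (R : realType) (z : R[i]) : `|complex.Im z| <= normc z.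
Proof.
rewrite -(@ler_pXn2r _ 2) ?nnegrE ?normc_ge0 // normc_sqr.
by rewrite real_normK ?num_real // lerDr sqr_ge0.
Qed.

Lemma cvg_Im (R : realType) (s : nat -> R[i]^o) (l : R[i]^o) :
  s @ \oo --> l -> (fun N => complex.Im (s N)) @ \oo --> complex.Im l.
Proof.
move=> /cvgrPdist_lt sl; apply/cvgrPdist_lt => e e0.
have e0' : 0 < e%:C%C by rewrite ltcR.
have := sl _ e0'; apply: filterS => N /= h.
have -> : complex.Im l - complex.Im (s N) = complex.Im (l - s N).
  by rewrite Im_add Im_opp.
by apply: le_lt_trans (Im_le_normc _) _; rewrite -ltcR.
Qed.

Lemma normc_cvg (R : realType) (s : nat -> R[i]^o) (l : R[i]^o) :
  (fun N => normc (l - s N)) @ \oo --> (0 : R) -> s @ \oo --> l.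
Proof.
move=> /cvgrPdist_lt sl; apply/cvgrPdist_lt => e e0.
have [x ex] : exists x : R, e = x%:C%C.
  by apply/complex_realP; rewrite realE (ltW e0).
rewrite ex ltcR in e0 *.
have := sl _ e0; apply: filterS => N /=; rewrite sub0r normrN ger0_norm ?normc_ge0 //.
by rewrite -ltcR.
Qed.

Lemma disk_normc (R : realType) (z : disk R) : normc (\val z) < 1.
Proof. by case: z => z /=; rewrite inE /disk /= -ltcR. Qed.

Definition kernel_fun (R : realType) (v : R) (z : disk R) : R[i]^o := (1 - v%:C%C * \val z)^-1.

Lemma kernel_taylor (R : realType) (v : R) : -1 < v < 1 ->
  taylor (kernel_fun v) (fun k => (v%:C%C : R[i]) ^+ k).
Proof.
move=> /andP[v0 v1] z; set q : R[i] := v%:C%C * \val z.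
have v1' : `|v| < 1 by rewrite ltr_norml v0.
have nq : normc q < 1.
  rewrite Normc.normcM normc_real; apply: le_lt_trans v1'.
  by rewrite ler_piMr // ltW // disk_normc.
have q1 : 1 - q != 0.
  apply/negP => /eqP e; have := normc1B_ge q.
  by rewrite e Normc.normc0 subr_le0 leNgt nq.
apply: normc_cvg.
rewrite (_ : (fun N => _) = (fun N => (normc (1 - q))^-1 * normc q ^+ N)).
  by apply: cvg_geometric; rewrite ger0_norm ?normc_ge0.
apply/funext => N; rewrite /series /= big_mkord.
rewrite (eq_bigr (fun k : 'I_N => q ^+ k)) => [|k _]; last by rewrite exprMn.
rewrite -normcX -Normc.normcV -Normc.normcM; congr normc.
apply: (mulfI q1); rewrite mulrA divff // mul1r mulrBr divff //.
by rewrite -[X in _ - X * _]opprB mulNr -subrX1; ring.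
Qed.


Lemma nneseries_le (R : realType) (f : nat -> R) (Q : R) :
  (forall k, 0 <= f k) -> (forall N, \sum_(k < N) f k <= Q) ->
  (\sum_(0 <= k <oo) (f k)%:E <= Q%:E)%E.
Proof.
move=> f0 fQ; apply: lime_le.
  by apply: is_cvg_nneseries => k _ _; rewrite lee_fin.
by apply: nearW => N; rewrite sumEFin lee_fin big_mkord.
Qed.

Lemma hardy_norm_le (R : realType) (f : disk R -> R[i]^o) (a : nat -> R[i]^o) (Q : R) :
  taylor f a -> (forall N, \sum_(k < N) normc (a k) ^+ 2 <= Q) ->
  (hardy_norm f <= (Num.sqrt Q)%:E)%E.
Proof.
move=> fa aQ; apply: (@le_trans _ _ (sqrte (\sum_(0 <= k <oo) (normc (a k) ^+ 2)%:E)%E)).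
  by apply: ereal_inf_lbound; exists a.
have Q0 : 0 <= Q by have := aQ 0%N; rewrite big_ord0.
rewrite -[X in (_ <= X)%E]/(sqrte Q%:E) lee_sqrt ?lee_fin //.
by apply: nneseries_le => // k; exact: sqr_ge0.
Qed.

(** The norm being an infimum over all Taylor sequences, a lower bound has to be
    checked on each of them; sequences that are not square summable cost nothing. *)
Lemma hardy_norm_ge (R : realType) (f : disk R -> R[i]^o) (c : R) :
  (forall a Q, taylor f a -> (forall N, \sum_(k < N) normc (a k) ^+ 2 <= Q) ->
     c <= Num.sqrt Q) ->
  (c%:E <= hardy_norm f)%E.
Proof.
move=> H; apply: le_ereal_inf_tmp => _ [a fa <-].
set A := (\sum_(0 <= k <oo) _)%E.
have A0 : (0 <= A)%E by apply: nneseries_ge0 => k _ _; rewrite lee_fin sqr_ge0.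
case AE : A A0 => [Q| |] //= _; last by rewrite leey.
rewrite lee_fin; apply: (H a) => // N.
rewrite -lee_fin -AE -sumEFin -(big_mkord xpredT (fun k => (normc (a k) ^+ 2)%:E)).
by apply: nneseries_lim_ge => k _ _; rewrite lee_fin sqr_ge0.
Qed.

Lemma kernel_hardy (R : realType) (v : R) : -1 < v < 1 -> kernel_fun v \in @hardy R.
Proof.
move=> v1; rewrite unfold_in /hardy.
apply: le_lt_trans (ltry (Num.sqrt (1 - v ^+ 2)^-1)).
apply: (hardy_norm_le (kernel_taylor v1)) => N.
rewrite (eq_bigr (fun k : 'I_N => (v ^+ 2) ^+ k)); last first.
  move=> k _; rewrite normcX normc_real -normrX real_normK ?num_real //.
  by rewrite exprAC.
apply: sum_geometric_le; first exact: sqr_ge0.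
by move: v1 => /andP[? ?]; nra.
Qed.

Definition kernel_H2 (R : realType) (v : R) (v1 : -1 < v < 1) : H2 R :=
  MkH2 (kernel_hardy v1).

Lemma H2val_sum (R : realType) (n : nat) (f : 'I_n -> H2 R) (y : 'I_n -> R[i])
    (z : disk R) :
  H2val (\sum_(j < n) y j *: f j) z = \sum_(j < n) y j * H2val (f j) z.
Proof.
rewrite -[H2val _]/(\val _) raddf_sum fct_sumE; apply: eq_bigr => j _.
by [].
Qed.

(** The coordinates of the images [S (f j)] form a matrix with fewer than [n]
    columns, which therefore has a nonzero left kernel. *)
Lemma rank_lt_kernel_combination (R : realType) (n : nat) (S : {linear H2 R -> H2 R})
    (f : 'I_n -> H2 R) :
  rank_lt n S -> exists2 y : 'I_n -> R[i], S (\sum_(j < n) y j *: f j) = 0 &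
    exists j, y j != 0.
Proof.
move=> [m [g [mn Sg]]].
have /choice[X XE] : forall j : 'I_n, exists x : 'I_m -> R[i],
  S (f j) = \sum_(i < m) x i *: g i by move=> j; exact: Sg.
pose A : 'M[R[i]]_(n, m) := \matrix_(j, i) X j i.
have : kermx A != 0.
  rewrite -mxrank_eq0 mxrank_ker subn_eq0 -ltnNge.
  exact: leq_ltn_trans (rank_leq_col _) mn.
move=> /rowV0Pn[y /sub_kermxP yA y0].
exists (fun j => y 0 j); last first.
  apply/existsP; apply: contra_neqT y0 => /existsPn h.
  by apply/rowP => j; rewrite mxE; apply/eqP; have := h j; rewrite negbK.
rewrite linear_sum; under eq_bigr do rewrite linearZ /= XE scaler_sumr.
rewrite exchange_big big1 // => i _ /=.
under eq_bigr do rewrite scalerA.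
rewrite -scaler_suml (_ : \sum_(j < n) _ = 0) ?scale0r //.
have /matrixP/(_ 0 i) := yA; rewrite mxE [RHS]mxE => E.
by rewrite -[RHS]E; apply: eq_bigr => j _; rewrite mxE.
Qed.

Lemma kernel_combination_taylor (R : realType) (n : nat) (v : 'I_n -> R)
    (v1 : forall i, -1 < v i < 1) (y : 'I_n -> R[i]) :
  taylor (H2val (\sum_(j < n) y j *: kernel_H2 (v1 j)))
    (fun k => \sum_(j < n) y j * (v j)%:C%C ^+ k : R[i]^o).
Proof.
move=> z; rewrite H2val_sum.
pose s j N : R[i]^o := (y j : R[i]^o) * series (fun k =>
  ((v j)%:C%C : R[i]^o) ^+ k * (\val z : R[i]^o) ^+ k) N.
have lim : (fun N => \sum_(j < n) s j N) @ \oo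
    --> \sum_(j < n) ((y j : R[i]^o) * kernel_fun (v j) z : R[i]^o).
  apply: (@cvg_sum R[i] (R[i]^o)) => j.
  by apply: cvgMl_tmp; exact: kernel_taylor.
apply: cvg_trans lim; apply: near_eq_cvg; apply: nearW => N.
rewrite /s /series /=.
under eq_bigr do rewrite mulr_sumr.
rewrite exchange_big; apply: eq_bigr => k _; rewrite mulr_suml.
by apply: eq_bigr => j _; rewrite mulrA.
Qed.

(** The points being real, real and imaginary parts of the coefficients separate,
    and [kernel_form_le] applies to each. *)
Lemma kernel_combination_norm_le (R : realType) (sigma : R) (n : nat) (v : 'I_n -> R)
    (v1 : forall i, -1 < v i < 1) (y : 'I_n -> R[i]) :
  0 < sigma < 1 -> decays sigma (fun i => cayley (v i)) ->
  (hardy_norm (H2val (\sum_(j < n) y j *: kernel_H2 (v1 j))%R)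
   <= (Num.sqrt (expR (24 / (1 - sigma)) * (8 / (1 - sigma))
     * \sum_(i < n) (1 - v i ^+ 2)
        * normc (\sum_(j < n) y j * ((1 - v i * v j)^-1)%:C%C) ^+ 2))%:E)%E.
Proof.
move=> s01 dec.
apply: (hardy_norm_le (@kernel_combination_taylor _ _ _ v1 y)) => N.
have ReE (x : 'I_n -> R) : complex.Re (\sum_(j < n) y j * (x j)%:C%C)
    = \sum_(j < n) complex.Re (y j) * x j.
  by rewrite Re_sum; apply: eq_bigr => j _; rewrite mulrC Re_scale mulrC.
have ImE (x : 'I_n -> R) : complex.Im (\sum_(j < n) y j * (x j)%:C%C)
    = \sum_(j < n) complex.Im (y j) * x j.
  by rewrite Im_sum; apply: eq_bigr => j _; rewrite mulrC Im_scale mulrC.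
under eq_bigr => k _.
  rewrite normc_sqr; under eq_bigr do rewrite -rmorphXn.
  rewrite ReE ImE; over.
under [X in _ <= _ * X]eq_bigr do rewrite normc_sqr ReE ImE mulrDr.
rewrite !big_split /= mulrDr.
by apply: lerD; (apply: le_trans (kernel_coef_le _ N v1) _;
  exact: kernel_form_le).
Qed.

(** * A lower bound for the distance to operators of small rank *)

Lemma carleson_hardy (R : realType) (sigma : R) (n : nat) (u : 'I_n -> R)
    (z : 'I_n -> disk R) (g : disk R -> R[i]^o) (a : nat -> R[i]^o) (Q : R) :
  0 < sigma < 1 -> (forall i, \val (z i) = (u i)%:C%C) ->
  (forall i, 0 <= u i < 1) -> decays sigma (fun i => cayley (u i)) ->
  taylor g a -> (forall N, \sum_(k < N) normc (a k) ^+ 2 <= Q) ->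
  \sum_(i < n) (1 - u i ^+ 2) * normc (g (z i)) ^+ 2 <= 8 / (1 - sigma) * Q.
Proof.
move=> s01 zu u01 dec ga aQ.
have C0 : 0 <= 8 / (1 - sigma) by move: s01 => /andP[_ ?]; rewrite divr_ge0 // subr_ge0 ltW.
pose s i N : R[i] := \sum_(k < N) a k * \val (z i) ^+ k.
have lims i : s i @ \oo --> (g (z i) : R[i]^o).
  apply: cvg_trans (ga (z i)); apply: near_eq_cvg; apply: nearW => N.
  by rewrite /series /= big_mkord.
have limR := fun i => cvg_Re (lims i); have limI := fun i => cvg_Im (lims i).
pose w i N : R := (1 - u i ^+ 2) * (complex.Re (s i N) * complex.Re (s i N)
  + complex.Im (s i N) * complex.Im (s i N)).
have lim : \sum_(i < n) w i N @[N --> \oo]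
    --> \sum_(i < n) (1 - u i ^+ 2) * (complex.Re (g (z i)) * complex.Re (g (z i))
      + complex.Im (g (z i)) * complex.Im (g (z i))).
  apply: (@cvg_sum R R^o) => i.
  rewrite /w; apply: cvgMl_tmp.
  by apply: cvgD; apply: cvgM.
under eq_bigr do rewrite normc_sqr !expr2.
apply: (cvgr_to_le lim); apply: nearW => N.
apply: le_trans (ler_wpM2l C0 (aQ N)).
rewrite /w; under eq_bigr do rewrite -!expr2 mulrDr.
under [X in _ <= _ * X]eq_bigr do rewrite normc_sqr.
rewrite !big_split /= mulrDr.
have sE i : s i N = \sum_(k < N) (u i ^+ k)%:C%C * a k.
  by apply: eq_bigr => k _; rewrite zu -rmorphXn mulrC.
apply: lerD.
  apply: le_trans (carleson_embedding (fun k => complex.Re (a k)) N s01 u01 dec).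
  apply: ler_sum => i _; rewrite sE Re_sum.
  by under eq_bigr do rewrite Re_scale mulrC.
apply: le_trans (carleson_embedding (fun k => complex.Im (a k)) N s01 u01 dec).
apply: ler_sum => i _; rewrite sE Im_sum.
by under eq_bigr do rewrite Im_scale mulrC.
Qed.

(** A combination [f] of kernels killed by [S] is normalised so that the
    interpolation estimate gives it norm at most 1; the Carleson embedding then
    bounds the norm of [f o phi] from below through the common values
    [f (phi (z i))]. *)
Lemma opnorm_interpolation_ge (R : realType) (phi : disk R -> disk R) (sigma mu : R)
    (n : nat) (u v : 'I_n -> R) (z : 'I_n -> disk R) (S : {linear H2 R -> H2 R}) :
  0 < sigma < 1 -> (forall i, \val (z i) = (u i)%:C%C) ->
  (forall i, \val (phi (z i)) = (v i)%:C%C) ->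
  (forall i, 0 <= u i < 1) -> (forall i, -1 < v i < 1) ->
  decays sigma (fun i => cayley (u i)) -> decays sigma (fun i => cayley (v i)) ->
  0 <= mu -> (forall i, mu * (1 - v i ^+ 2) <= 1 - u i ^+ 2) ->
  rank_lt n S ->
  ((Num.sqrt mu * expR (- (12 / (1 - sigma))) * (1 - sigma) / 8)%:E
   <= opnorm (fun f => composition_op phi f - H2val (S f))%R)%E.
Proof.
move=> s01 zu phizu u01 v1 decu decv mu0 muv rkS.
have /andP[s0 s1] := s01.
have [y0 Sy0 [j0 yj0]] := rank_lt_kernel_combination (fun j => kernel_H2 (v1 j)) rkS.
pose d (y : 'I_n -> R[i]) i := \sum_(j < n) y j * ((1 - v i * v j)^-1)%:C%C.
set C := 8 / (1 - sigma); set E := expR (12 / (1 - sigma)).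
have C0 : 0 < C by rewrite divr_gt0 // subr_gt0.
have E0 : 0 < E by exact: expR_gt0.
have E2 : expR (24 / (1 - sigma)) = E ^+ 2.
  by rewrite expr2 -expRD; congr expR; ring.
pose Q y := \sum_(i < n) (1 - v i ^+ 2) * normc (d y i) ^+ 2.
have w0 i : 0 < 1 - v i ^+ 2 by have /andP[? ?] := v1 i; nra.
have Q0 : 0 < Q y0.
  rewrite lt_neqAle eq_sym sumr_ge0 ?andbT => [|i _]; last first.
    by rewrite mulr_ge0 ?sqr_ge0 // ltW.
  apply: contra_neq yj0 => Qy0.
  have dy0 i : d y0 i = 0.
    apply: Normc.eq0_normc; apply/eqP; rewrite -sqrf_eq0.
    have := @psumr_eq0P _ _ xpredT (fun i => (1 - v i ^+ 2) * normc (d y0 i) ^+ 2) _ Qy0 i isT.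
    move=> /(_ _)/eqP; rewrite mulf_eq0 gt_eqF //=; apply=> k _.
    by rewrite mulr_ge0 ?sqr_ge0 // ltW.
  have Re0 : complex.Re (y0 j0) = 0.
    apply: (kernel_nondegenerate (y := fun j => complex.Re (y0 j)) s01 v1 decv) => i.
    rewrite -[RHS]/(complex.Re (0 : R[i])) -(dy0 i) Re_sum.
    by apply: eq_bigr => j _; rewrite [in RHS]mulrC Re_scale mulrC.
  have Im0 : complex.Im (y0 j0) = 0.
    apply: (kernel_nondegenerate (y := fun j => complex.Im (y0 j)) s01 v1 decv) => i.
    rewrite -[RHS]/(complex.Im (0 : R[i])) -(dy0 i) Im_sum.
    by apply: eq_bigr => j _; rewrite [in RHS]mulrC Im_scale mulrC.
  by apply/eqP; rewrite eq_complex Re0 Im0 /= !eqxx.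
(* the factor that makes the bound of [kernel_combination_norm_le] equal to 1 *)
pose t := (E * Num.sqrt (C * Q y0))^-1.
have t0 : 0 < t by rewrite invr_gt0 mulr_gt0 // sqrtr_gt0 mulr_gt0.
pose y j := t%:C%C * y0 j.
have dE i : d y i = t%:C%C * d y0 i.
  by rewrite /d mulr_sumr; apply: eq_bigr => j _; rewrite mulrA.
have QE : E ^+ 2 * C * Q y = 1.
  have -> : Q y = t ^+ 2 * Q y0.
    rewrite /Q mulr_sumr; apply: eq_bigr => i _.
    rewrite dE Normc.normcM normc_real gtr0_norm //; ring.
  have CQ0 : 0 < C * Q y0 by rewrite mulr_gt0.
  rewrite /t exprVn exprMn sqr_sqrtr ?ltW //; field.
  by rewrite !gt_eqF.
pose f : H2 R := \sum_(j < n) y j *: kernel_H2 (v1 j).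
have Sf : S f = 0.
  have -> : f = t%:C%C *: \sum_(j < n) y0 j *: kernel_H2 (v1 j).
    by rewrite scaler_sumr; apply: eq_bigr => j _; rewrite scalerA.
  by rewrite linearZ /= Sy0 scaler0.
have f1 : (hardy_norm (H2val f) <= 1)%E.
  have := kernel_combination_norm_le v1 y s01 decv.
  by rewrite -/C E2 -/(Q y) QE sqrtr1.
have fv i : normc (H2val f (phi (z i))) = normc (d y i).
  congr normc; rewrite H2val_sum; apply: eq_bigr => j _; congr (_ * _).
  rewrite /= /kernel_fun phizu mulrC -rmorphM -(rmorph1 (real_complex R)) -rmorphB.
  by rewrite fmorphV.
apply: le_trans (ereal_sup_ubound _); last by exists f.
rewrite Sf (_ : _ - _ = composition_op phi f); last by rewrite /= subr0.
apply: hardy_norm_ge => a A fa aA.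
have h := carleson_hardy s01 zu u01 decu fa aA.
have {}h : mu * Q y <= C * A.
  apply: le_trans h; rewrite mulr_sumr; apply: ler_sum => i _.
  by rewrite mulrA -fv ler_wpM2r ?sqr_ge0.
have -> : Num.sqrt mu * expR (- (12 / (1 - sigma))) * (1 - sigma) / 8
    = Num.sqrt mu / (E * C).
  by rewrite expRN -/E /C; clearbody E; field; rewrite !gt_eqF //= ?subr_gt0.
have A0 : 0 <= A by have := aA 0%N; rewrite big_ord0.
have L0 : 0 <= Num.sqrt mu / (E * C).
  exact: divr_ge0 (sqrtr_ge0 _) (mulr_ge0 (ltW E0) (ltW C0)).
rewrite -(@ler_pXn2r _ 2) ?nnegrE ?sqrtr_ge0 //.
rewrite exprMn !sqr_sqrtr // exprVn.
have -> : mu / (E * C) ^+ 2 = mu * Q y / C * (E ^+ 2 * C * Q y)^-1.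
  have EC : E != 0 /\ C != 0 by split; rewrite gt_eqF.
  have QN0 : Q y != 0 by apply: contra_eq_neq QE => ->; rewrite mulr0 eq_sym oner_neq0.
  by clearbody E C; case: EC => ? ?; field; apply/and3P.
by rewrite QE invr1 mulr1 ler_pdivrMr // [leRHS]mulrC.
Qed.

(** * Points on the radius *)

Definition disk_point (R : realType) (z : R[i]) : disk R :=
  insubd (disk0 R) (z : R[i]^o).

Lemma val_disk_point (R : realType) (z : R[i]) : normc z < 1 ->
  \val (disk_point z) = z.
Proof.
by move=> z1; rewrite val_insubd ifT // inE /disk /= -[1]/(1%:C%C) ltcR.
Qed.

Definition radial_defect (R : realType) (phi : disk R -> disk R) (x : R) : R :=
  1 - complex.Re (\val (phi (disk_point x%:C%C))).

Lemma continuous_at_disk (R : realType) (f : disk R -> R[i]^o) (z : disk R) :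
  analytic f -> {for \val z, continuous ('valL_0 f)}.
Proof.
by move=> fa; apply: differentiable_continuous; apply/derivable1_diffP; exact: fa.
Qed.

Lemma radial_defect_continuous (R : realType) (phi : disk R -> disk R) (r : R) :
  analytic (fun z => \val (phi z)) -> r < 1 ->
  {within `[0, r], continuous (radial_defect phi)}.
Proof.
move=> pa r1; apply: continuous_in_subspaceT => x; rewrite inE /= in_itv /= => /andP[x0 xr].
have x1 : x < 1 := le_lt_trans xr r1.
have nc (y : R) : `|y| < 1 -> normc y%:C%C < 1 by rewrite normc_real.
have x1' : `|x| < 1 by rewrite ger0_norm.
have vE z : 'valL_0 (fun z => \val (phi z)) (\val z) = \val (phi z).
  exact: (congr1 (@^~ z) (valLK 0 (fun z => \val (phi z)))).
apply: cvgB; first exact: cvg_cst.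
apply/cvgrPdist_lt => e e0.
have := @continuous_at_disk _ _ (disk_point x%:C%C) pa.
rewrite val_disk_point ?nc // => /cvgrPdist_lt/(_ e%:C%C).
rewrite ltcR => /(_ e0).
move=> /nbhs_ballP[d /= d0 hd].
have [d' dE] : exists d' : R, d = d'%:C%C.
  by apply/complex_realP; rewrite realE (ltW d0).
rewrite dE ltcR in d0.
near=> y.
have y1 : `|y| < 1 by near: y; exact: (@cvgr_norm_lt _ _ _ (nbhs x) _ id x cvg_id 1 x1').
have xy : `|x - y| < d' by near: y; exact: (@cvgr_dist_lt _ _ _ (nbhs x) _ id x cvg_id _ d0).
have bxy : ball (x%:C%C : R[i]^o) d y%:C%C.
  by rewrite /ball /= -rmorphB normc_def /= expr0n addr0 sqrtr_sqr dE ltcR.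
have ptE t : `|t| < 1 -> 'valL_0 (fun z => \val (phi z)) (t%:C%C : R[i]^o)
    = \val (phi (disk_point t%:C%C)).
  by move=> t1; rewrite -vE val_disk_point ?nc.
have : `|'valL_0 (fun z => \val (phi z)) (x%:C%C : R[i]^o)
    - 'valL_0 (fun z => \val (phi z)) (y%:C%C : R[i]^o)| < e%:C%C by exact: hd bxy.
rewrite !ptE // => h.
rewrite /radial_defect.
rewrite -Re_opp -Re_add; apply: le_lt_trans (Re_le_normc _) _.
by rewrite -ltcR.
Unshelve. all: by end_near.
Qed.

Lemma modulus_attains (R : realType) (omega : R -> R) (s : R) :
  modulus_of_continuity 1 omega -> 0 <= s <= omega 1 ->
  exists2 x, 0 <= x <= 1 & omega x = s.
Proof.
move=> m /andP[s0 s1].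
have := @IVT _ omega 0 1 s ler01 (modulus_continuous m).
rewrite (modulus0 m) => /(_ _)[|x]; last by rewrite in_itv /= => ? ?; exists x.
have w1 : 0 <= omega 1 := le_trans s0 s1.
by rewrite (min_idPl w1) (max_idPr w1) s0.
Qed.

Lemma modulus_le (R : realType) (omega : R -> R) (x y : R) :
  modulus_of_continuity 1 omega -> 0 <= x <= 1 -> 0 <= y <= 1 ->
  omega x <= omega y -> x <= y.
Proof.
move=> m x01 y01 xy; rewrite leNgt; apply/negP => yx.
by have := modulus_increasing m y01 x01 yx; rewrite ltNge xy.
Qed.

Lemma modulus_lt (R : realType) (omega : R -> R) (x y : R) :
  modulus_of_continuity 1 omega -> 0 <= x <= 1 -> 0 <= y <= 1 ->
  omega x < omega y -> x < y.
Proof.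
move=> m x01 y01 xy; rewrite lt_neqAle (modulus_le m) ?(ltW xy) // andbT.
by apply: contraTneq xy => ->; rewrite ltxx.
Qed.

Lemma modulus_inv_ge0 (R : realType) (omega : R -> R) (s : R) :
  modulus_of_continuity 1 omega -> 0 <= s <= omega 1 ->
  0 <= modulus_inv 1 omega s.
Proof.
move=> m /(modulus_attains m)[x x01 <-]; rewrite modulus_invK //.
by have /andP[] := x01.
Qed.

(** By concavity [omega x / x] is nonincreasing. *)
Lemma modulus_inv_ratio_le (R : realType) (omega : R -> R) (s s' x : R) :
  modulus_of_continuity 1 omega -> 0 < s -> s <= s' -> 0 <= x <= 1 ->
  s' <= omega x -> modulus_inv 1 omega s / s <= x / s'.
Proof.
move=> m s0 ss' x01 s'x; have s'0 : 0 < s' := lt_le_trans s0 ss'.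
have /andP[x0 x1] := x01.
have w1 : omega x <= omega 1.
  have := x1; rewrite le_eqVlt => /predU1P[->//|xlt1]; apply: ltW.
  by apply: (modulus_increasing m) => //; rewrite in_itv /= ?ler01 ?lexx.
have [y y01 ys] : exists2 y, 0 <= y <= 1 & omega y = s.
  apply: (modulus_attains m); rewrite (ltW s0) /=.
  exact: le_trans ss' (le_trans s'x w1).
rewrite -{1}ys modulus_invK //; have /andP[y0 y1] := y01.
have yx : y <= x by apply: (modulus_le m) => //; rewrite ys (le_trans ss').
have xp : 0 < x.
  rewrite lt_neqAle x0 andbT; apply: contraTneq s'x => <-.
  by rewrite (modulus0 m) -ltNge.
have l0 : 0 <= y / x by rewrite divr_ge0.
have l1 : y / x <= 1 by rewrite ler_pdivrMr // mul1r.
have /(_ (Itv01 l0 l1) x 0) := modulus_concave m.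
rewrite !inE /= !in_itv /= x01 lexx ler01 => /(_ isT isT).
rewrite convRE /= [conv _ _ _](_ : _ = y); last first.
  by rewrite /conv /= scaler0 addr0 -[LHS]/(y / x * x) divfK // gt_eqF.
rewrite (modulus0 m) oppr0 mulr0 addr0 mulrN lerN2 ys => h.
have {}h : y / x * s' <= s by apply: le_trans h; rewrite ler_wpM2l.
rewrite ler_pdivrMr // mulrAC ler_pdivlMr //.
rewrite -(ler_pM2l xp) in h; apply: le_trans h.
by rewrite mulrA mulrCA divff ?gt_eqF // mulr1.
Qed.

(** The radial condition provides a point where the defect is at most [s], namely
    [1 - y] with [omega y = s]; the intermediate value theorem does the rest. *)
Lemma next_radial_point (R : realType) (phi : disk R -> disk R) (omega : R -> R)
    (x s : R) :
  analytic (fun z => \val (phi z)) -> radial_symbol omega phi ->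
  0 <= x < 1 -> 0 < s -> s < radial_defect phi x ->
  exists y, [/\ x < y, y < 1 & radial_defect phi y = s].
Proof.
move=> pa [_ m _ rad] /andP[x0 x1] s0 sx.
have le_omega t : 0 <= t -> t < 1 -> radial_defect phi t <= omega (1 - t).
  move=> t0 t1; have := rad (disk_point t%:C%C).
  by rewrite val_disk_point ?normc_real ?ger0_norm //=; exact.
have x01 : 0 <= 1 - x <= 1 by lra.
have h1 := le_omega _ x0 x1.
have w1 : omega (1 - x) <= omega 1.
  have [->|xN0] := eqVneq x 0; first by rewrite subr0.
  have xp : 0 < x by rewrite lt_neqAle eq_sym xN0.
  by apply/ltW/(modulus_increasing m); rewrite ?in_itv /= ?ler01 ?lexx //; lra.
have [y y01 ys] : exists2 y, 0 <= y <= 1 & omega y = s.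
  by apply: (modulus_attains m); rewrite (ltW s0) /= (le_trans (ltW sx)) // (le_trans h1).
have yx : y < 1 - x by apply: (modulus_lt m) => //; rewrite ys (lt_le_trans sx).
have y0 : 0 < y by apply: (modulus_lt m) => //; rewrite ?lexx ?ler01 // (modulus0 m) ys.
have xr : x <= 1 - y by lra.
have r1 : 1 - y < 1 by lra.
have hr : radial_defect phi (1 - y) <= s.
  by have := le_omega _ (le_trans x0 xr) r1; rewrite subKr ys.
have cont : {within `[x, 1 - y], continuous (radial_defect phi)}.
  apply: continuous_subspaceW (radial_defect_continuous pa r1).
  by move=> t /=; rewrite !in_itv /= => /andP[xt ->]; rewrite (le_trans x0).
have sr : radial_defect phi (1 - y) <= radial_defect phi x := le_trans hr (ltW sx).
have := IVT xr cont; move=> /(_ s); rewrite (min_idPr sr) (max_idPl sr) hr (ltW sx).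
move=> /(_ isT)[c]; rewrite in_itv /= => /andP[xc cr] cs.
exists c; split=> //; last exact: le_lt_trans r1.
by rewrite lt_neqAle xc andbT; apply: contraTneq sx => ->; rewrite cs ltxx.
Qed.

Lemma radial_points (R : realType) (phi : disk R -> disk R) (omega : R -> R)
    (sigma : R) :
  analytic (fun z => \val (phi z)) -> radial_symbol omega phi -> 0 < sigma < 1 ->
  0 < radial_defect phi 0 ->
  exists u : nat -> R, forall j,
    [/\ 0 <= u j < 1, u j < u j.+1 &
        radial_defect phi (u j) = radial_defect phi 0 * sigma ^+ j].
Proof.
move=> pa rad /andP[s0 s1]; set a := radial_defect phi 0 => a0.
pose next (p : nat * R) y := 0 <= p.2 < 1 -> radial_defect phi p.2 = a * sigma ^+ p.1 ->
  [/\ p.2 < y, y < 1 & radial_defect phi y = a * sigma ^+ p.1.+1].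
have /choice[f fP] : forall p, exists y, next p y.
  move=> [j x].
  have [[x01 xa]|] := pselect (0 <= x < 1 /\ radial_defect phi x = a * sigma ^+ j).
    have as0 : 0 < a * sigma ^+ j by rewrite mulr_gt0 // exprn_gt0.
    have [||y yP] := next_radial_point (s := a * sigma ^+ j.+1) pa rad x01.
    - by rewrite mulr_gt0 // exprn_gt0.
    - by rewrite xa exprSr mulrA gtr_pMr.
    - by exists y => _ _; exact: yP.
  by move=> N; exists 0 => x01 xa; exfalso; exact: N.
pose u := fix u j := if j is k.+1 then f (k, u k) else 0 : R.
have uP j : 0 <= u j < 1 /\ radial_defect phi (u j) = a * sigma ^+ j.
  elim: j => [|j [u01 ua]]; first by rewrite lexx ltr01 expr0 mulr1.
  have [h1 h2 h3] := fP (j, u j) u01 ua.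
  split=> //; rewrite -[u j.+1]/(f (j, u j)) h2 andbT.
  by move: u01 => /andP[u0 _]; exact: le_trans u0 (ltW h1).
exists u => j; have [u01 ua] := uP j.
by split=> //; have [] := fP (j, u j) u01 ua.
Qed.

(** * Decay of the points and conclusion *)

Lemma identity_taylor (R : realType) :
  taylor (fun z : disk R => \val z) (fun k => (k == 1%N)%:R : R[i]^o).
Proof.
move=> z; apply: (@cvg_trans _ ((fun _ : nat => \val z) @ \oo)); last exact: cvg_cst.
apply: near_eq_cvg; exists 2%N => // -[//|[//|N]] _ /=.
rewrite /series /= big_mkord 2!big_ord_recl /= mul0r add0r mul1r expr1 big1 ?addr0 //.
by move=> k _; rewrite mul0r.
Qed.

Lemma identity_coef_le (R : realType) (N : nat) :
  \sum_(k < N) normc ((k == 1%N :> nat)%:R : R[i]) ^+ 2 <= 1 :> R.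
Proof.
have E (b : bool) : normc (b%:R : R[i]) ^+ 2 = b%:R.
  by case: b; rewrite ?Normc.normc1 ?Normc.normc0 ?expr1n ?expr0n.
under eq_bigr do rewrite E.
case: N => [|[|N]]; first by rewrite big_ord0 ler01.
  by rewrite big_ord1 ler01.
by rewrite 2!big_ord_recl /= add0r big1 ?addr0.
Qed.

Lemma identity_hardy (R : realType) : (fun z : disk R => \val z) \in @hardy R.
Proof.
rewrite unfold_in /hardy; apply: le_lt_trans (ltry (Num.sqrt 1)).
exact: hardy_norm_le (@identity_taylor R) (@identity_coef_le R).
Qed.

Definition identity_H2 (R : realType) : H2 R := MkH2 (identity_hardy R).

(** The symbol is the image of the identity function, which differs from its image
    under [S] by an element of finite norm. *)
Lemma hardy_symbol (R : realType) (phi : disk R -> disk R) (S : H2 R -> H2 R) :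
  (opnorm (fun f => composition_op phi f - H2val (S f))%R < +oo)%E ->
  (fun z => \val (phi z)) \in @hardy R.
Proof.
move=> Noo.
have h : (fun z => \val (phi z)) - H2val (S (identity_H2 R)) \in @hardy R.
  rewrite unfold_in /hardy; apply: le_lt_trans Noo.
  apply: ereal_sup_ubound; exists (identity_H2 R) => //=.
  rewrite -sqrtr1; exact: hardy_norm_le (@identity_taylor R) (@identity_coef_le R).
have hS : H2val (S (identity_H2 R)) \in @hardy R by case: (S (identity_H2 R)).
have := rpredD h hS; by rewrite subrK.
Qed.

Lemma Re_disk_lt1 (R : realType) (z : disk R) : complex.Re (\val z) < 1.
Proof. by apply: le_lt_trans (ler_norm _) (le_lt_trans (Re_le_normc _) (disk_normc z)). Qed.

(** The Taylor coefficients are bounded because they are square summable. *)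
Lemma radial_defect_harnack (R : realType) (phi : disk R -> disk R) (u w : R) :
  (fun z => \val (phi z)) \in @hardy R -> 0 <= u -> u < w -> w < 1 ->
  cayley w * radial_defect phi u <= cayley u * radial_defect phi w.
Proof.
move=> /hardyP[b phib bfin] u0 uw w1.
set Q := (\sum_(0 <= k <oo) _)%E in bfin.
have bQ k : ((normc (b k) ^+ 2)%:E <= Q)%E.
  apply: le_trans (nneseries_lim_ge k.+1 _); last by move=> ? _ _; rewrite lee_fin sqr_ge0.
  rewrite big_nat_recr //= leeDr // sume_ge0 // => i _; by rewrite lee_fin sqr_ge0.
have [q QE] : exists q, Q = q%:E.
  case: Q bfin bQ => [q _ _|//|_ /(_ 0%N)//]; by exists q.
have bB k : normc (b k) <= Num.sqrt q.
  by rewrite -[leLHS]ger0_norm ?normc_ge0 // -sqrtr_sqr ler_wsqrtr // -lee_fin -QE.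
apply: (@harnack _ b (Num.sqrt q) (fun z => complex.Re (\val (phi (disk_point z))))) => //.
- move=> z z1; have := cvg_Re (phib (disk_point z)).
  apply: cvg_trans; apply: near_eq_cvg; apply: nearW => N.
  by rewrite /series /= big_mkord val_disk_point.
- by move=> z _; exact/ltW/Re_disk_lt1.
Qed.

(** In [radial_defect_harnack] the defects are powers of [sigma] up to
    a common factor, so that it compares the Cayley images directly. *)
Lemma decays_radial (R : realType) (phi : disk R -> disk R) (sigma a : R) (n : nat)
    (u : nat -> R) :
  (fun z => \val (phi z)) \in @hardy R -> 0 < sigma < 1 -> 0 < a ->
  (forall j, [/\ 0 <= u j < 1, u j < u j.+1 &
        radial_defect phi (u j) = a * sigma ^+ j]) ->
  decays sigma (fun i : 'I_n => cayley (u i.+1)).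
Proof.
move=> ph /andP[s0 s1] a0 uP i j ij.
have [->|iNj] := eqVneq i j; first by rewrite subnn expr0 mul1r.
have {ij} ij : (i < j)%N by rewrite ltn_neqAle ij andbT.
have uij : u i.+1 < u j.+1.
  apply: (@homo_ltn _ u (fun x y => x < y)) => //; first by move=> ? ? ?; exact: lt_trans.
  by move=> k; have [] := uP k.
have [/andP[ui0 _] _ ui] := uP i.+1; have [/andP[_ uj1] _ uj] := uP j.+1.
have := radial_defect_harnack ph ui0 uij uj1; rewrite ui uj.
have -> : sigma ^+ j.+1 = sigma ^+ (j - i) * sigma ^+ i.+1.
  by rewrite -exprD addnS subnK // ltnW.
rewrite [leRHS](_ : _ = sigma ^+ (j - i) * cayley (u i.+1) * (a * sigma ^+ i.+1));
  last by ring.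
by rewrite ler_pM2r // mulr_gt0 // exprn_gt0.
Qed.

Lemma decays_geometric (R : realType) (sigma a : R) (n : nat) :
  0 < sigma < 1 -> 0 < a < 2 ->
  decays sigma (fun i : 'I_n => cayley (1 - a * sigma ^+ i.+1)).
Proof.
move=> /andP[s0 s1] /andP[a0 a2] i j ij.
set q := sigma ^+ (j - i).
have q0 : 0 < q by rewrite exprn_gt0.
have q1 : q <= 1 by rewrite exprn_ile1 // ltW.
have -> : sigma ^+ j.+1 = q * sigma ^+ i.+1 by rewrite -exprD addnS subnK.
have p0 : 0 < sigma ^+ i.+1 by rewrite exprn_gt0.
have p1 : sigma ^+ i.+1 < 1 by rewrite exprn_ilt1 // ltW.
have b0 : 0 < a * sigma ^+ i.+1 by rewrite mulr_gt0.
have b2 : a * sigma ^+ i.+1 < 2 by rewrite (lt_trans _ a2) // gtr_pMr.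
rewrite mulrCA; move: (a * _) b0 b2 => b b0 b2; rewrite /cayley.
have qb : q * b <= b by rewrite ler_piMl // ltW.
have E (x : R) : (1 - (1 - x)) / (1 + (1 - x)) = x / (2 - x) by congr (_ / _); ring.
rewrite !E mulrA ler_wpM2l ?mulr_ge0 ?(ltW b0) ?(ltW q0) //.
by rewrite lef_pV2 ?posrE; lra.
Qed.

Unset Implicit Arguments.

Theorem theorem3p2 (R : realType) (phi : disk R -> disk R)
    (phi_analytic : analytic (fun z => \val (phi z)))
    (phi_real : real_symbol phi) :
  exists c : R, 0 < c /\
    forall omega : R -> R, radial_symbol omega phi ->
    forall n : nat, (1 <= n)%N ->
    let a := 1 - complex.Re (\val (phi (disk0 R))) in
    (c%:E * ereal_sup
       [set (Num.sqrt (modulus_inv 1 omega (a * sigma ^+ n)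
                         / (a * sigma ^+ n))
             * expR (- (20 / (1 - sigma))))%:E
       | sigma in `]0%R, 1%R[%classic]
     <= approx_number n (composition_op phi))%E.
Proof.
exists 16^-1; split=> [|omega rad n n1]; first by rewrite invr_gt0.
cbv zeta; set a := 1 - complex.Re (\val (phi (disk0 R))).
apply: le_ereal_inf_tmp => _ [S [_ rkS] <-].
have [->|Noo] := eqVneq (opnorm (fun f => composition_op phi f - H2val (S f))%R) +oo%E.
  by rewrite leey.
have {}Noo : (opnorm (fun f => composition_op phi f - H2val (S f))%R < +oo)%E.
  by rewrite ltey.
rewrite -lee_pdivlMl ?invr_gt0 //; apply: ge_ereal_sup => _ [sigma + <-].
rewrite /= in_itv /= => s01; rewrite lee_pdivlMl ?invr_gt0 // -EFinM.
have /andP[s0 s1] := s01.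
have aE : radial_defect phi 0 = a.
  rewrite /radial_defect /a; congr (1 - complex.Re (\val (phi _))).
  by apply: val_inj; rewrite val_disk_point ?Normc.normc0.
have a0 : 0 < a by rewrite subr_gt0 Re_disk_lt1.
have Re_gt z : -1 < complex.Re (\val (phi z)).
  have := le_lt_trans (Re_le_normc _) (disk_normc (phi z)).
  by rewrite ltr_norml => /andP[].
have a2 : a < 2 by have := Re_gt (disk0 R); rewrite /a; lra.
have [|u uP] := radial_points phi_analytic rad s01; first by rewrite aE.
rewrite aE in uP; have ph := hardy_symbol Noo.
pose v (i : 'I_n) := 1 - a * sigma ^+ i.+1.
have vE (i : 'I_n) : complex.Re (\val (phi (disk_point (u i.+1)%:C%C))) = v i.
  by have [_ _ e] := uP i.+1; rewrite /v -e subKr.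
have uC j : normc (u j)%:C%C < 1.
  by have [/andP[? ?] _ _] := uP j; rewrite normc_real ger0_norm.
have ptE j : \val (disk_point (u j)%:C%C) = (u j)%:C%C by rewrite val_disk_point.
set m := modulus_inv 1 omega (a * sigma ^+ n) / (a * sigma ^+ n).
have as0 j : 0 < a * sigma ^+ j by rewrite mulr_gt0 // exprn_gt0.
have [_ mod _ radial] := rad.
have le_omega j : a * sigma ^+ j <= omega (1 - u j).
  have [/andP[u0 _] _ <-] := uP j.
  by have := radial (disk_point (u j)%:C%C); rewrite ptE /=; exact.
have m0 : 0 <= m.
  rewrite divr_ge0 ?(ltW (as0 _)) // modulus_inv_ge0 // (ltW (as0 _)) /=.
  have aw : a <= omega 1 by have := radial (disk0 R); rewrite /= subr0; apply.
  by apply: le_trans aw; rewrite ger_pMr // exprn_ile1 // ltW.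
have v1 i : -1 < v i < 1 by rewrite -vE Re_gt Re_disk_lt1.
(* the ratio of weights is at least [m / 2]; the smaller [m / 4] has a simpler root *)
apply: (@le_trans _ _ (Num.sqrt (m / 4) * expR (- (12 / (1 - sigma))) * (1 - sigma) / 8)%:E).
  rewrite lee_fin [Num.sqrt (m / 4)]sqrtrM //.
  have -> : Num.sqrt 4^-1 = 2^-1 :> R.
    have -> : 4^-1 = (2^-1) ^+ 2 :> R by field.
    by rewrite sqrtr_sqr ger0_norm // invr_ge0.
  have d0 : 0 < 1 - sigma by rewrite subr_gt0.
  have -> : expR (- (20 / (1 - sigma))) = expR (- (12 / (1 - sigma)))
      * expR (- (8 / (1 - sigma))) by rewrite -expRD; congr expR; ring.
  have h : expR (- (8 / (1 - sigma))) <= 1 - sigma.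
    rewrite expRN -[leRHS]invrK lef_pV2 ?posrE ?expR_gt0 ?invr_gt0 //.
    apply: le_trans (expR_ge1Dx _).
    have : 0 < (1 - sigma)^-1 by rewrite invr_gt0.
    lra.
  rewrite [leRHS](_ : _ = 16^-1 * (Num.sqrt m * (expR (- (12 / (1 - sigma))) * (1 - sigma)))).
    by rewrite !ler_wpM2l ?invr_ge0 ?sqrtr_ge0 ?expR_ge0.
  by field.
apply: (opnorm_interpolation_ge (u := fun i : 'I_n => u i.+1) (v := v)
  (z := fun i : 'I_n => disk_point (u i.+1)%:C%C) s01) => //.
- by move=> i; apply/eqP; rewrite eq_complex /= vE eqxx; apply/eqP/phi_real; rewrite ptE.
- by move=> i; have [] := uP i.+1.
- exact: (decays_radial ph s01 a0 uP).
- by apply: decays_geometric => //; rewrite a0.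
- by rewrite divr_ge0.
move=> i; have [/andP[u0 u1] _ _] := uP i.+1.
have mu_le : m <= (1 - u i.+1) / (a * sigma ^+ i.+1).
  apply: (modulus_inv_ratio_le mod) => //; last by lra.
  by rewrite ler_pM2l // ler_wiXn2l // ltW.
rewrite ler_pdivlMr // in mu_le.
have {}mu_le : m * (1 - v i) <= 1 - u i.+1 by rewrite /v subKr.
have /andP[v0 v1'] := v1 i.
have : m * (1 - v i) * (1 + v i) <= (1 - u i.+1) * (1 + v i) by rewrite ler_pM2r //; lra.
have : (1 - u i.+1) * (1 + v i) <= (1 - u i.+1) * 2 by rewrite ler_pM2l; lra.
have : 0 <= (1 - u i.+1) * u i.+1 by rewrite mulr_ge0 //; lra.
clearbody m v; lra.
Qed.
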